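(* Let $n\ge3$ and $1\le\alpha<\beta\le n-1$. For every exchangeable (mutable) variable $\varphi$ in the initial cluster $\mathcal B_{\alpha\beta}$ of the seed $(\mathcal B_{\alpha\beta},Q^n_{\alpha\beta})$, the exchanged variable $\varphi'$ obtained by mutating the initial seed once at $\varphi$ is a regular function on $GL_n$ (and, after setting $\varphi_{11}=\det X=1$, on $SL_n$).
   Context: **Functions.** $X=(x_{ij})$ is the $n\times n$ matrix of coordinates, $X_R^C$ the submatrix with row set $R$, column set $C$, $[a,b]=\{a,\dots,b\}$. Let $$f_{ij}=\det X_{[i,n+i-j]}^{[j,n]}\ (j\ge i),\qquad f_{ij}=\det X_{[i,n]}^{[j,n-i+j]}\ (j<i).$$ If $f=f_{ij}=\det X_{[i,k]}^{[j,\ell]}$, then $f^{\rightarrow}$ (resp. $f^{\leftarrow}$, $f^{\downarrow}$, $f^{\uparrow}$) is the determinant obtained by replacing the last column $\ell$ by column $\ell+1$ of $X$ (resp. first column $j$ by column $j-1$; last row $k$ by row $k+1$; first row $i$ by row $i-1$), within the same rows (resp. columns). For $k\in[1,\alpha]$, $m\in[1,\beta]$ set, when $\alpha\ne n/2$ and $\beta\neq n/2$, $$\theta_k=f_{n+k-\alpha,k}f_{1,\beta+1}-f_{n+k-\alpha,k}^{\rightarrow}f_{1,\beta+1}^{\leftarrow},\qquad \psi_m=f_{m,n+m-\beta}f_{\alpha+1,1}-f_{m,n+m-\beta}^{\downarrow}f_{\alpha+1,1}^{\uparrow}.$$ If $\beta=n/2$, set $\psi_m=f_{m,n+m-\beta}f_{\alpha+1,1}-f_{m,n+m-\beta}^{\downarrow}f_{\alpha+1,1}^{\uparrow}$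 and $\theta_k=f_{n+k-\alpha,k}\,\psi_1-f_{n+k-\alpha,k}^{\rightarrow}\,\psi_1^{*}$ with $\psi_1^*=\det X_{[1,\beta]}^{\{\beta\}\cup[\beta+2,n]}f_{\alpha+1,1}-\det X_{[1,\beta-1]\cup\{\beta+1\}}^{\{\beta\}\cup[\beta+2,n]}f^{\uparrow}_{\alpha+1,1}$. If $\alpha=n/2$, set $\theta_k=f_{n+k-\alpha,k}f_{1,\beta+1}-f_{n+k-\alpha,k}^{\rightarrow}f_{1,\beta+1}^{\leftarrow}$ and $\psi_m=f_{m,n+m-\beta}\,\theta_1-f^{\downarrow}_{m,n+m-\beta}\,\theta_1^*$ with $\theta_1^*=\det X_{\{\alpha\}\cup[\alpha+2,n]}^{[1,\alpha]}f_{1,\beta+1}-\det X_{\{\alpha\}\cup[\alpha+2,n]}^{[1,\alpha-1]\cup\{\alpha+1\}}f_{1,\beta+1}^{\leftarrow}$. Then $\varphi_{n+k-\alpha,k}=\theta_k$ for $k\in[1,\alpha]$, $\varphi_{m,n+m-\beta}=\psi_m$ for $m\in[1,\beta]$, $\varphi_{ij}=f_{ij}$ for all other $(i,j)$, and $\mathcal B_{\alpha\beta}=\{\varphi_{ij}:i,j\in[1,n]\}$. **Quiver $Q^n_{\alpha\beta}$.** Vertices are $(i,j)\in[1,n]^2$ ($i$ = row, $j$ = column), vertex $(i,j)$ carrying $\varphi_{ij}$. Frozen (non-exchangeable) vertices: all $(i,1)$ and $(1,j)$ except $(\alpha+1,1)$ and $(1,\beta+1)$, which are mutable. Arrows: first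 take all arrows $(i,j)\to(i,j+1)$ ($j<n$), $(i,j)\to(i+1,j)$ ($i<n$), $(i+1,j+1)\to(i,j)$ ($i,j<n$), except those joining two vertices both lying in $\{(i,1)\}\cup\{(1,j)\}$; then add the arrows $(\alpha,1)\to(\alpha+1,1)$, $(1,\beta)\to(1,\beta+1)$, $(n,\alpha+1)\to(1,\beta+1)$, $(1,\beta+1)\to(n,\alpha)$, $(\beta+1,n)\to(\alpha+1,1)$, $(\alpha+1,1)\to(\beta,n)$. **Mutation.** For a mutable vertex $p$, the exchanged variable $\varphi_p'$ is the rational function defined by $\varphi_p\varphi_p'=\prod_{p\to q}\varphi_q+\prod_{q\to p}\varphi_q$ (products over arrows out of, resp. into, $p$). *)

(* Defs.v *)
From HB Require Import structures.
From mathcomp Require Import all_boot all_order all_algebra.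
From mathcomp Require Import mpoly.

Set Implicit Arguments.
Unset Strict Implicit.
Unset Printing Implicit Defensive.

Import GRing.Theory.
Local Open Scope ring_scope.

(* Rows, columns and quiver vertices are numbered from 1, by natural numbers.
   Everything built from X is a polynomial in the entries of X; it is defined
   over any commutative ring so that it applies both to the generic matrix and
   to matrices of scalars. *)

Definition vertex := (nat * nat)%type.

(* The integer interval [a, b]. *)
Definition itv (a b : nat) : seq nat := iota a (b.+1 - a).

Section InitialCluster.
Variables (R : comNzRingType) (n : nat) (X : 'M[R]_n) (alpha beta : nat).

(* x_{ij}; indices outside [1, n] never occur below when
   1 <= alpha < beta <= n - 1, and get the junk value 0. *)
Definition entry (i j : nat) : R :=
  match [pick a : 'I_n | a.+1 == i], [pick b : 'I_n | b.+1 == j] with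
  | Some a, Some b => X a b
  | _, _ => 0
  end.

(* Only used with size rs = size cs. *)
Definition minor (rs cs : seq nat) : R :=
  \det (\matrix_(a < size rs, b < size rs)
          entry (nth 0%N rs a) (nth 0%N cs b)).

(* The quadruple (i, k, j, l) stands for the block of rows [i, k] and columns
   [j, l]: the moves below depend on the block, not only on its determinant. *)
Record block := Block { top : nat; bot : nat; left : nat; right : nat }.

Definition det_block (d : block) : R :=
  minor (itv (top d) (bot d)) (itv (left d) (right d)).
Definition det_right (d : block) : R :=
  minor (itv (top d) (bot d))
        (rcons (itv (left d) (right d).-1) (right d).+1).
Definition det_left (d : block) : R :=
  minor (itv (top d) (bot d))
        ((left d).-1 :: itv (left d).+1 (right d)).
Definition det_down (d : block) : R :=
  minor (rcons (itv (top d) (bot d).-1) (bot d).+1)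
        (itv (left d) (right d)).
Definition det_up (d : block) : R :=
  minor ((top d).-1 :: itv (top d).+1 (bot d))
        (itv (left d) (right d)).

Definition fblock (i j : nat) : block :=
  if (i <= j)%N then Block i (n + i - j) j n else Block i n j (n + j - i).

Definition f (i j : nat) : R := det_block (fblock i j).
Definition f_right (i j : nat) : R := det_right (fblock i j).
Definition f_left (i j : nat) : R := det_left (fblock i j).
Definition f_down (i j : nat) : R := det_down (fblock i j).
Definition f_up (i j : nat) : R := det_up (fblock i j).

(* The generic formulas for theta_k and psi_m, valid for theta unless
   beta = n/2 and for psi unless alpha = n/2. *)
Definition theta_gen (k : nat) : R :=
  f (n + k - alpha) k * f 1 beta.+1
  - f_right (n + k - alpha) k * f_left 1 beta.+1.
Definition psi_gen (m : nat) : R :=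
  f m (n + m - beta) * f alpha.+1 1
  - f_down m (n + m - beta) * f_up alpha.+1 1.

Definition psi1_star : R :=
  minor (itv 1 beta) (beta :: itv beta.+2 n) * f alpha.+1 1
  - minor (rcons (itv 1 beta.-1) beta.+1) (beta :: itv beta.+2 n)
    * f_up alpha.+1 1.
Definition theta1_star : R :=
  minor (alpha :: itv alpha.+2 n) (itv 1 alpha) * f 1 beta.+1
  - minor (alpha :: itv alpha.+2 n) (rcons (itv 1 alpha.-1) alpha.+1)
    * f_left 1 beta.+1.

Definition theta (k : nat) : R :=
  if beta.*2 == n then
    f (n + k - alpha) k * psi_gen 1 - f_right (n + k - alpha) k * psi1_star
  else theta_gen k.
Definition psi (m : nat) : R :=
  if alpha.*2 == n then
    f m (n + m - beta) * theta_gen 1 - f_down m (n + m - beta) * theta1_star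
  else psi_gen m.

Definition phi (v : vertex) : R :=
  let: (i, j) := v in
  if (1 <= j <= alpha)%N && (i == n + j - alpha)%N then theta j
  else if (1 <= i <= beta)%N && (j == n + i - beta)%N then psi i
  else f i j.

End InitialCluster.

Section Quiver.
Variables (n alpha beta : nat).

Definition on_border (v : vertex) : bool := (v.1 == 1%N) || (v.2 == 1%N).

Definition is_mutable (v : vertex) : bool :=
  [|| ~~ on_border v, v == (alpha.+1, 1%N) | v == (1%N, beta.+1)].

Definition grid_arrow (p q : vertex) : bool :=
  [|| q == (p.1, p.2.+1), q == (p.1.+1, p.2) | p == (q.1.+1, q.2.+1)].

Definition extra_arrows : seq (vertex * vertex) :=
  [:: ((alpha, 1%N), (alpha.+1, 1%N));
      ((1%N, beta), (1%N, beta.+1));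
      ((n, alpha.+1), (1%N, beta.+1));
      ((1%N, beta.+1), (n, alpha));
      ((beta.+1, n), (alpha.+1, 1%N));
      ((alpha.+1, 1%N), (beta, n))].

(* For n >= 3 the extra arrows are distinct from each other and from the grid
   arrows that are kept, so every arrow has multiplicity one and a relation on
   vertices determines the quiver. *)
Definition arrow (p q : vertex) : bool :=
  (grid_arrow p q && ~~ (on_border p && on_border q))
  || ((p, q) \in extra_arrows).

Definition lbl (v : 'I_n * 'I_n) : vertex := (v.1.+1, v.2.+1).

End Quiver.

(* The right-hand side of the exchange relation at p. *)
Definition exchange (R : comNzRingType) (n : nat) (X : 'M[R]_n)
    (alpha beta : nat) (p : vertex) : R :=
  \prod_(q : 'I_n * 'I_n | arrow n alpha beta p (lbl q))
     phi X alpha beta (lbl q)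
  + \prod_(q : 'I_n * 'I_n | arrow n alpha beta (lbl q) p)
     phi X alpha beta (lbl q).

Section RegularFunctions.
Variables (C : fieldType) (n : nat).

Definition genericX : 'M[{mpoly C[n * n]}]_n :=
  \matrix_(i, j) 'X_(mxvec_index i j).

Definition eval_at (A : 'M[C]_n) (P : {mpoly C[n * n]}) : C :=
  P.@[fun t => mxvec A 0 t].

(* g belongs to the coordinate ring C[x_ij, 1 / det X] of GL_n. *)
Definition regular_GL (g : {fraction {mpoly C[n * n]}}) : Prop :=
  exists (P : {mpoly C[n * n]}) (k : nat),
    g = FracField.tofrac P / FracField.tofrac (\det genericX) ^+ k.

Definition regular_SL (h : 'M[C]_n -> C) : Prop :=
  exists P : {mpoly C[n * n]},
    forall A : 'M[C]_n, \det A = 1 -> h A = eval_at A P.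

(* The exchanged variable phi'_p, as an element of the field C(x_ij). *)
Definition exchanged (alpha beta : nat) (p : vertex) :
    {fraction {mpoly C[n * n]}} :=
  FracField.tofrac (exchange genericX alpha beta p)
  / FracField.tofrac (phi genericX alpha beta p).

(* h represents the exchanged variable on SL_n: it satisfies the exchange
   relation of the seed restricted to SL_n, where phi_11 = det X = 1. *)
Definition exchanged_SL (alpha beta : nat) (p : vertex)
    (h : 'M[C]_n -> C) : Prop :=
  forall A : 'M[C]_n, \det A = 1 ->
    phi A alpha beta p * h A = exchange A alpha beta p.

End RegularFunctions.

(* Main.v *)
Require Import Defs.
From HB Require Import structures.
From mathcomp Require Import all_boot all_order all_algebra.
From mathcomp Require Import mpoly.
From mathcomp Require Import fingroup perm zify ring.
Import GRing.Theory.
Import Num.Theory.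
Local Open Scope ring_scope.

(** Why every exchanged variable is regular.

    Append to the n x n matrix X the columns n + c = (-1)^(c-1) e_(n-c+1),
    for c = 1, ..., n.  Then f_ij is, for all i and j, the minor A_ij of the
    extended matrix with rows [i, n] and columns [j, n + j - i] ([f_trail]),
    and the two modifications that enter theta and psi become the same one:
    both f_ij^right for j < i and f_ij^down for i < j are the minor A'_ij
    obtained from A_ij by replacing its last column by the next column of the
    extended matrix ([f_right_trail], [f_down_trail]).  Hence every variable is

      phi_ij = A_ij u - A'_ij w,

    where the pair (u, w) depends only on the diagonal j - i ([phiE]): it is
    (1, 0), except on the diagonals of the theta_k and of the psi_m, where u is
    phi_(1,beta+1), resp. phi_(alpha+1,1), and w is the modified version of u.
    The degenerate cases beta = n/2 and alpha = n/2 only change the values of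
    u and w.  The same formula, read at the positions just outside the grid,
    gives 1 in general, but phi_(1,beta+1) at (n+1, alpha+1) and
    phi_(alpha+1,1) at (beta+1, n+1): this is what the extra arrows of the
    quiver say, so the exchange relation has the same shape at all interior
    vertices, those of the last row and column included
    ([prod_out], [prod_in]).

    For the pairs (1, 0) the exchange relation follows from the three-term
    Pluecker relation applied to two nested blocks ([exchange_minors]).
    At most one of the three consecutive diagonals met by an exchange relation
    is special ([coefs_near]), so that the relation is linear in (u, w); its
    coefficient at u is [exchange_minors], its coefficient at w is
    [exchange_minors] with one column replaced, or with two columns exchanged
    ([Phi_exchange]).  At the two mutable border vertices the variable divides
    the exchange polynomial because of a Pluecker relation and of a
    Desnanot-Jacobi identity ([corner_theta_exchange], [corner_psi_exchange]).
    Altogether phi_v divides its exchange polynomial over every commutative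
    ring ([exchange_divisible]); for the generic matrix the quotient is a
    polynomial, and it evaluates to the exchanged variable on SL_n.

    The variables do not vanish on SL_n.  For x_ij = t^(ij) a minor has degree
    sum r_i c_i in t, by the rearrangement inequality
    ([size_minor_power_mx]), so that the two terms of phi_ij have different
    degrees ([phi_power_mx_neq0]).  A value of t at which neither phi_ij nor
    the determinant vanishes, and a rescaling of the matrix, give a point of
    SL_n ([phi_nonzero_SL]). *)

Set Implicit Arguments.
Unset Strict Implicit.
Unset Printing Implicit Defensive.

(** * The three-term Pluecker relation *)

(** Minors of an array of entries with arbitrary indices, so that rows and columns
    may be adjoined to a matrix. Locked: two different minors must not be
    compared by unfolding their determinants. *)
HB.lock Definition minor_of (R : comNzRingType) (F : nat -> nat -> R)
    (rs cs : seq nat) : R :=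
  \det (\matrix_(a < size rs, b < size rs) F (nth 0%N rs a) (nth 0%N cs b)).

Section Pluecker.
Variable R : comNzRingType.

Definition set_col k (M : 'M[R]_k) (j : 'I_k) (v : 'I_k -> R) : 'M[R]_k :=
  \matrix_(r, c) if c == j then v r else M r c.

Lemma cofactor_set_col k (M : 'M[R]_k) j v r :
  cofactor (set_col M j v) r j = cofactor M r j.
Proof.
case: k M j v r => [|k] M j v r; first by case: j.
rewrite /cofactor; congr (_ * \det _); apply/matrixP=> a b.
by rewrite !mxE eq_sym (negPf (neq_lift _ _)).
Qed.

Lemma det_set_col k (M : 'M[R]_k) j v :
  \det (set_col M j v) = \sum_r v r * cofactor M r j.
Proof.
rewrite (expand_det_col _ j); apply: eq_bigr => r _.
by rewrite cofactor_set_col mxE eqxx.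
Qed.

(** Compute the entry (j1, p) of adj(L) K adj(K) in both ways: K adj(K) is scalar,
    and adj(L) K differs from the scalar matrix adj(L) L in column j0 only. *)
Lemma pluecker_mx k (K : 'M[R]_k) (v : 'I_k -> R) (p j0 j1 : 'I_k) :
  j0 != j1 -> let L := set_col K j0 v in
  \det K * cofactor L p j1 =
    \det L * cofactor K p j1
    + \det (set_col L j1 (fun r => K r j0)) * cofactor K p j0.
Proof.
move=> j01 L.
have /matrixP/(_ j1 p) : \adj L *m (K *m \adj K) = \adj L *m K *m \adj K.
  by rewrite mulmxA.
rewrite mul_mx_adj mul_mx_scalar.
rewrite [LHS]mxE [\adj L _ _]mxE => ->.
have LK c : (\adj L *m K) j1 c = if c == j0 then
    \det (set_col L j1 (fun r => K r j0)) else \det L *+ (j1 == c).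
  case: eqP => [->|/eqP c0].
    rewrite det_set_col mxE; apply: eq_bigr => r _.
    by rewrite mxE mulrC.
  have /matrixP/(_ j1 c) := mul_adj_mx L.
  rewrite [RHS]mxE => <-; rewrite !mxE; apply: eq_bigr => r _.
  by rewrite [L r c]mxE (negPf c0).
rewrite [LHS]mxE (bigD1 j0) //= (bigD1 j1) 1?eq_sym //= big1 ?addr0 => [|c /andP[c0 c1]].
  rewrite !LK eqxx eq_sym (negPf j01) eqxx mulr1n [\adj K _ _]mxE [\adj K j1 _]mxE.
  by rewrite addrC.
by rewrite LK (negPf c0) eq_sym (negPf c1) mulr0n mul0r.
Qed.

Variable F : nat -> nat -> R.
Implicit Types (rs cs S T M N : seq nat).

Lemma minor_ofE rs cs k : size rs = k ->
  minor_of F rs cs = \det (\matrix_(a < k, b < k) F (nth 0%N rs a) (nth 0%N cs b)).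
Proof. by rewrite minor_of.unlock => <-. Qed.

Lemma minor_of_swap rs M N x y : (size M + 2 <= size rs)%N ->
  minor_of F rs (M ++ x :: y :: N) = - minor_of F rs (M ++ y :: x :: N).
Proof.
move=> sz; rewrite minor_of.unlock.
have h0 : (size M < size rs)%N by lia.
have h1 : ((size M).+1 < size rs)%N by lia.
pose i0 := Ordinal h0; pose i1 := Ordinal h1.
have n01 : i0 != i1 by rewrite -val_eqE /=; lia.
set A := (\matrix_(_, _) _) ; set B := (\matrix_(_, _) _).
suff -> : A = xcol i0 i1 B.
  by rewrite xcolE det_mulmx det_perm odd_tperm n01 expr1 mulrN1.
apply/matrixP => a b; rewrite !mxE; congr (F _ _).
case: tpermP => [->|->|/eqP b0 /eqP b1] /=.
- by rewrite !nth_cat ltnn subnn ltnNge leqnSn /= subSnn.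
- by rewrite !nth_cat ltnn subnn ltnNge leqnSn /= subSnn.
move: b0 b1; rewrite -!val_eqE /= => b0 b1.
rewrite !nth_cat; case: ltnP => // hb.
have -> : (b - size M = (b - size M).-2.+2)%N by lia.
by [].
Qed.

Lemma minor_of_rot rs N x M : (size N + 1 <= size rs)%N ->
  minor_of F rs (x :: N ++ M) = (-1) ^+ size N * minor_of F rs (N ++ x :: M).
Proof.
suff H L : (size L + size N + 1 <= size rs)%N ->
    minor_of F rs (L ++ x :: N ++ M) = (-1) ^+ size N * minor_of F rs (L ++ N ++ x :: M).
  exact: (H [::]).
elim: N L => [|y N IH] L /= sz; first by rewrite expr0 mul1r.
rewrite minor_of_swap; last by lia.
rewrite -cat_rcons IH ?size_rcons; last by lia.
by rewrite cat_rcons exprS mulN1r mulNr.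
Qed.

(** [pluecker_mx] for K = (N, b, c) and L = (N, a, c): the cofactors along the row p
    are the minors with rows T. *)
Lemma pluecker p T N a b c : size T = (size N).+1 ->
  minor_of F (p :: T) (N ++ [:: b; c]) * minor_of F T (N ++ [:: a])
  - minor_of F (p :: T) (N ++ [:: a; c]) * minor_of F T (N ++ [:: b])
  + minor_of F (p :: T) (N ++ [:: a; b]) * minor_of F T (N ++ [:: c]) = 0.
Proof.
move=> sT; set m := size N in sT *.
have e1 : size (p :: T) = m.+2 by rewrite /= sT.
rewrite !(minor_ofE _ e1) !(minor_ofE _ sT).
pose K : 'M[R]_m.+2 := \matrix_(i, j) F (nth 0%N (p :: T) i) (nth 0%N (N ++ [:: b; c]) j).
have h0 : (m < m.+2)%N by [].
pose j0 := Ordinal h0; pose j1 : 'I_m.+2 := ord_max.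
have n01 : j0 != j1 by rewrite -val_eqE /=; lia.
have := pluecker_mx K (fun r => F (nth 0%N (p :: T) r) a) ord0 n01 => /=.
set L := set_col _ _ _; set L2 := set_col _ _ _.
have -> : L = \matrix_(i < m.+2, j < m.+2) F (nth 0%N (p :: T) i) (nth 0%N (N ++ [:: a; c]) j).
  apply/matrixP => i j; rewrite !mxE.
  rewrite -val_eqE /= !nth_cat; case: eqP => [->|hj]; first by rewrite ltnn subnn.
  case: ltnP => // hm; suff -> : (j - size N = 1)%N by [].
  by have := ltn_ord j; rewrite -/m; lia.
have -> : L2 = \matrix_(i < m.+2, j < m.+2) F (nth 0%N (p :: T) i) (nth 0%N (N ++ [:: a; b]) j).
  apply/matrixP => i j; rewrite !mxE -!val_eqE /= !nth_cat ltnn subnn /=.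
  case: eqP => [->|hj]; first by rewrite ltnNge leqnSn /= subSnn.
  case: eqP => [->|hj']; first by rewrite ltnn subnn.
  by case: ltnP => // hm; have := ltn_ord j; rewrite -/m in hm *; lia.
have cofE x y : cofactor (\matrix_(i < m.+2, j < m.+2) F (nth 0%N (p :: T) i)
      (nth 0%N (N ++ [:: x; y]) j)) ord0 j1 =
    (-1) ^+ m.+1 * \det (\matrix_(i < m.+1, j < m.+1) F (nth 0%N T i) (nth 0%N (N ++ [:: x]) j)).
  rewrite /cofactor; congr (_ * \det _); apply/matrixP => i j; rewrite !mxE.
  congr (F _ _); rewrite lift_max !nth_cat; case: ltnP => // hm.
  suff -> : (j - size N = 0)%N by [].
  by have := ltn_ord j; rewrite -/m; lia.
have -> : cofactor K ord0 j0 =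
    (-1) ^+ m * \det (\matrix_(i < m.+1, j < m.+1) F (nth 0%N T i) (nth 0%N (N ++ [:: c]) j)).
  rewrite /cofactor; congr (_ * \det _); apply/matrixP => i j; rewrite !mxE.
  congr (F _ _); rewrite /= /bump !nth_cat; have := ltn_ord j; rewrite -/m.
  case: (leqP m j) => hj hj2 /=.
    have -> : (j = m :> nat) by lia.
    by rewrite add1n ltnNge leqnSn /= subSnn subnn.
  by rewrite add0n hj.
rewrite !cofE exprS => H.
(* The expansions along row p all carry the sign (-1)^m or its opposite. *)
have sq : (-1) ^+ m * (-1) ^+ m = 1 :> R by rewrite -expr2 sqrr_sign.
rewrite -[LHS]mul1r -sq -[LHS]mulrA.
set s := (-1) ^+ m in H sq *.
set x1 := \det _ in H *; set y1 := \det _ in H *; set x2 := \det _ in H *; set y2 := \det _ in H *.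
set x3 := \det _ in H *; set y3 := \det _ in H *.
have -> : s * (x1 * y1 - x2 * y2 + x3 * y3) =
   - (x1 * (-1 * s * y1)) + x2 * (-1 * s * y2) + x3 * (s * y3) by ring.
by rewrite H; ring.
Qed.

End Pluecker.

(** * Relations between minors sharing rows and columns *)

(** Makes the minors of the goal atomic before [ring]. *)
Ltac generalize_minors := repeat
  match goal with |- context [minor_of ?F ?r ?c] => move: (minor_of F r c) => ? end.

Section Relations.
Variable R : comNzRingType.
Implicit Types (F : nat -> nat -> R) (rs cs S T M N : seq nat).

Lemma minor_of_unit_col F (r1 : seq nat) (b : nat) (r2 c1 : seq nat) e c2 :
  (size c1 <= size (r1 ++ r2))%N ->
  {in r1 ++ r2, forall r, F r e = 0} ->
  minor_of F (r1 ++ b :: r2) (c1 ++ e :: c2)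
  = (-1) ^+ (size r1 + size c1) * F b e * minor_of F (r1 ++ r2) (c1 ++ c2).
Proof.
set k := size (r1 ++ r2) => sc F0.
have sr : size (r1 ++ b :: r2) = k.+1 by rewrite /k !size_cat /= addnS.
rewrite (minor_ofE _ _ sr).
have hi : (size r1 < k.+1)%N by rewrite /k size_cat; lia.
pose i0 := Ordinal hi; pose j0 : 'I_k.+1 := Ordinal (sc : (size c1 < k.+1)%N).
rewrite (expand_det_col _ j0) (bigD1 i0) //= big1 ?addr0 => [|i ne]; last first.
  rewrite mxE /= (_ : F _ _ = 0) ?mul0r //.
  rewrite [X in F _ X]nth_cat ltnn subnn /= F0 //.
  rewrite nth_cat mem_cat; case: ltnP => h; first by rewrite mem_nth.
  have {}ne : nat_of_ord i <> size r1 by move=> E; case/eqP: ne; apply: val_inj.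
  have -> : (i - size r1 = (i - size r1).-1.+1)%N by lia.
  rewrite /= mem_nth ?orbT //.
  have hk : k = (size r1 + size r2)%N by rewrite /k size_cat.
  have aux (x s t u : nat) : (s <= x)%N -> x <> s -> u = (s + t)%N ->
    (x < u.+1)%N -> ((x - s).-1 < t)%N by lia.
  exact: aux h ne hk (ltn_ord i).
rewrite mxE /= !nth_cat !ltnn !subnn /= /cofactor mulrA [F b e * _]mulrC minor_of.unlock.
congr (_ * \det _); apply/matrixP => i j; rewrite !mxE /= /bump.
have nthE (s1 s2 : seq nat) x l :
    nth 0%N (s1 ++ x :: s2) ((size s1 <= l) + l)%N = nth 0%N (s1 ++ s2) l.
  rewrite !nth_cat; case: (leqP (size s1) l) => h; rewrite ?add1n ?add0n ?h //.
  by rewrite ltnNge leqW //= subSn //.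
by rewrite !nthE.
Qed.

(** The form in which the relation is used for blocks of consecutive columns,
    a being the column to the left of N. *)
Lemma pluecker_front F p T N a y z : size T = (size N).+1 ->
  minor_of F (p :: T) (N ++ [:: y; z]) * minor_of F T (a :: N)
  = minor_of F (p :: T) (a :: N ++ [:: z]) * minor_of F T (N ++ [:: y])
  - minor_of F (p :: T) (a :: N ++ [:: y]) * minor_of F T (N ++ [:: z]).
Proof.
move=> sT; have := pluecker F p a y z sT.
rewrite !minor_of_rot /= ?sT; try lia.
rewrite -[in minor_of F T (a :: N)](cats0 N) minor_of_rot ?sT; last by lia.
move: (_ ^+ size N) => s H; apply/eqP; rewrite -subr_eq0; apply/eqP.
by rewrite -[RHS](mulr0 s) -H; generalize_minors; ring.
Qed.

(** The exchange relation of three consecutive diagonals of blocks. The rows p, q and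
    the columns a, b are the first ones, y and z the last columns. Two
    instances of [pluecker_front], one with first row p and one with first row
    q, rewrite each term of the left-hand side; what is not a multiple of the
    minor with rows q, S and columns b, M, y cancels. *)
Lemma exchange_minors F p q S a b M y z : size S = (size M).+1 ->
  minor_of F S (b :: M) * minor_of F (q :: S) (M ++ [:: y; z])
    * minor_of F (p :: q :: S) (a :: b :: M ++ [:: y])
  + minor_of F (q :: S) (a :: b :: M) * minor_of F (p :: q :: S) (b :: M ++ [:: y; z])
    * minor_of F S (M ++ [:: y])
  = minor_of F (q :: S) (b :: M ++ [:: y])
    * (minor_of F (p :: q :: S) (a :: b :: M ++ [:: z]) * minor_of F S (M ++ [:: y])
       - minor_of F (p :: q :: S) (a :: b :: M ++ [:: y]) * minor_of F S (M ++ [:: z])).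
Proof.
move=> sS; have := @pluecker_front F p (q :: S) (b :: M) a y z.
rewrite /= sS => /(_ erefl) H1; have H2 := pluecker_front F q b y z sS.
rewrite [minor_of F S (b :: M) * _]mulrC H2.
rewrite [minor_of F _ (a :: _) * minor_of F (p :: _) (b :: _)]mulrC H1.
by generalize_minors; ring.
Qed.

Lemma minor_of_rot2 F rs a b M : (size M + 2 <= size rs)%N ->
  minor_of F rs (a :: b :: M) = minor_of F rs (M ++ [:: a; b]).
Proof.
move=> sz; rewrite -[b :: M]cats0 minor_of_rot /=; last by lia.
rewrite minor_of_rot; last by lia.
rewrite minor_of_swap // exprS.
have := sqrr_sign R (size M); move: (_ ^+ size M) => s s2.
by rewrite mulrN mulN1r mulNr mulrN opprK mulrA -expr2 s2 mul1r.
Qed.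

(** Pluecker relation for a, b, y over M: it compares a block with the block whose
    first column is moved one step to the left. *)
Lemma left_shift_minors F p S a b M y : size S = (size M).+1 ->
  minor_of F (p :: S) (a :: M ++ [:: y]) * minor_of F S (b :: M)
  - minor_of F (p :: S) (a :: b :: M) * minor_of F S (M ++ [:: y])
  = minor_of F (p :: S) (b :: M ++ [:: y]) * minor_of F S (a :: M).
Proof.
move=> sS; rewrite minor_of_rot2 /= ?sS; last by lia.
have := pluecker F p a b y sS.
rewrite ![minor_of F (p :: S) (_ :: M ++ _)]minor_of_rot /= ?sS; try lia.
have e x : minor_of F S (x :: M) = (-1) ^+ size M * minor_of F S (M ++ [:: x]).
  by rewrite -[in LHS](cats0 M) minor_of_rot // sS; lia.
rewrite !e.
have := sqrr_sign R (size M); move: (_ ^+ size M) => s s2 H.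
apply/eqP; rewrite -subr_eq0; apply/eqP; rewrite -oppr0 -H.
set h1 := minor_of _ _ _ in H *; set g1 := minor_of _ _ _ in H *;
set h2 := minor_of _ _ _ in H *; set g2 := minor_of _ _ _ in H *;
set h3 := minor_of _ _ _ in H *; set g3 := minor_of _ _ _ in H *.
transitivity (s ^+ 2 * (h2 * g2) - h3 * g3 - s ^+ 2 * (h1 * g1)); first by ring.
by rewrite s2; ring.
Qed.

(** Desnanot-Jacobi identity. It is [left_shift_minors] once the unit column
    supported on row b is adjoined: expanding along this column deletes row b. *)
Lemma desnanot F (a b : nat) S c M y : size S = size M -> b != a -> b \notin S ->
  minor_of F (a :: S) (c :: M) * minor_of F (b :: S) (M ++ [:: y])
  - minor_of F (a :: b :: S) (c :: M ++ [:: y]) * minor_of F S M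
  = minor_of F (b :: S) (c :: M) * minor_of F (a :: S) (M ++ [:: y]).
Proof.
move=> sS ba bS.
(* Column 0 of F' is the unit column; column c of F has become column c + 1. *)
pose F' r l := if l is l'.+1 then F r l' else (r == b)%:R.
have F'E rs cs : (size rs <= size cs)%N -> minor_of F rs cs = minor_of F' rs (map succn cs).
  move=> sz; rewrite minor_of.unlock; congr (\det _); apply/matrixP => i j; rewrite !mxE.
  by rewrite (nth_map 0%N) ?(leq_trans (ltn_ord j)).
have F'S : {in S, forall r, F' r 0%N = 0}.
  by move=> r rS; rewrite /F' (negPf (memPn bS r rS)).
have F'aS : {in a :: S, forall r, F' r 0%N = 0}.
  by move=> r; rewrite inE => /orP[/eqP->|/F'S//]; rewrite /F' eq_sym (negPf ba).
rewrite !F'E /= ?map_cat ?size_cat /= ?sS ?addn1 //; set N := map succn M.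
have sN : size (b :: S) = (size N).+1 by rewrite /= sS size_map.
have := left_shift_minors F' a 0%N c.+1 y.+1 sN.
have e1 : minor_of F' (a :: b :: S) (0%N :: N ++ [:: y.+1]) = - minor_of F' (a :: S) (N ++ [:: y.+1]).
  by have := @minor_of_unit_col F' [:: a] b S [::] 0%N (N ++ [:: y.+1]) isT F'aS;
  rewrite /= expr1 eqxx mulr1 mulN1r.
have e2 : minor_of F' (a :: b :: S) [:: 0%N, c.+1 & N] = - minor_of F' (a :: S) (c.+1 :: N).
  by have := @minor_of_unit_col F' [:: a] b S [::] 0%N (c.+1 :: N) isT F'aS;
  rewrite /= expr1 eqxx mulr1 mulN1r.
have e3 : minor_of F' (b :: S) (0%N :: N) = minor_of F' S N.
  by have := @minor_of_unit_col F' [::] b S [::] 0%N N isT F'S;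
  rewrite /= expr0 eqxx !mul1r.
by rewrite e1 e2 e3 => <-; generalize_minors; ring.
Qed.

End Relations.

(** * Intervals, and the matrix extended by signed unit columns *)

Lemma size_itv a b : size (itv a b) = (b.+1 - a)%N.
Proof. exact: size_iota. Qed.

Lemma mem_itv a b x : (x \in itv a b) = (a <= x <= b)%N.
Proof. by rewrite mem_iota; lia. Qed.

Lemma itv_cat a m b : (a <= m.+1)%N -> (m <= b)%N ->
  itv a b = itv a m ++ itv m.+1 b.
Proof.
move=> am mb; rewrite /itv.
have -> : (b.+1 - a = (m.+1 - a) + (b.+1 - m.+1))%N by lia.
by rewrite iotaD; congr (_ ++ iota _ _); lia.
Qed.

Lemma itv_cons a b : (a <= b)%N -> itv a b = a :: itv a.+1 b.
Proof. by move=> ab; rewrite (@itv_cat a a) ///itv subSnn. Qed.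

Lemma itv_rcons a b : (a <= b.+1)%N -> itv a b.+1 = itv a b ++ [:: b.+1].
Proof. by move=> ab; rewrite (@itv_cat a b) // {2}/itv subSnn. Qed.

Lemma itv_nil a b : (b < a)%N -> itv a b = [::].
Proof. by move=> ab; rewrite /itv (_ : _ - _ = 0)%N //; lia. Qed.

Lemma itv1 a : itv a a = [:: a].
Proof. by rewrite /itv subSnn. Qed.

Lemma last_itv a b x : (a <= b)%N -> last x (itv a b) = b.
Proof.
case: b => [|b] ab; first by rewrite (_ : a = 0%N) //; lia.
by rewrite itv_rcons // last_cat.
Qed.

Lemma sorted_itv a b : sorted ltn (itv a b).
Proof. exact: iota_ltn_sorted. Qed.

Lemma sorted_cons_itv a b c : (a < b)%N -> sorted ltn (a :: itv b c).
Proof.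
move=> ab; rewrite /= (path_sortedE ltn_trans) sorted_itv andbT.
by apply/allP => x; rewrite mem_itv /=; lia.
Qed.

Lemma sorted_rcons_itv a b c : (b < c)%N -> sorted ltn (rcons (itv a b) c).
Proof.
move=> ab; rewrite (sorted_pairwise ltn_trans) pairwise_rcons.
rewrite -(sorted_pairwise ltn_trans) sorted_itv andbT.
by apply/allP => x; rewrite mem_itv /=; lia.
Qed.

Section Extended.
Variables (R : comNzRingType) (n : nat) (X : 'M[R]_n).
Implicit Types rs cs : seq nat.

(** Column n + c is (-1)^(c-1) e_(n-c+1). The unit vectors come in reverse order so that
    adding one more column kills the last row that is not yet killed, and the
    signs make the minors agree without sign in [minor_of_peel]. *)
Definition ext_entry (i j : nat) : R :=
  if (j <= n)%N then entry X i j
  else if (i + j == n.*2.+1)%N then (-1) ^+ (j - n.+1) else 0.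

Lemma minor_ext rs cs : {in cs, forall c, c <= n}%N ->
  minor X rs cs = minor_of ext_entry rs cs.
Proof.
move=> csn; rewrite minor_of.unlock; congr (\det _); apply/matrixP => i j.
rewrite !mxE /ext_entry; suff -> : (nth 0 cs j <= n)%N by [].
case: (ltnP j (size cs)) => hj; first by apply/csn/mem_nth.
by rewrite nth_default.
Qed.

Lemma ext_entry_unit e : (n < e)%N -> (e <= n.*2)%N ->
  ext_entry (n.*2.+1 - e) e = (-1) ^+ (e - n.+1).
Proof. by move=> h1 h2; rewrite /ext_entry leqNgt h1 /= subnK ?eqxx //; lia. Qed.

Lemma ext_entry_zero r e : (n < e)%N -> (r + e != n.*2.+1)%N -> ext_entry r e = 0.
Proof. by move=> h1 h2; rewrite /ext_entry leqNgt h1 (negPf h2). Qed.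

(** Expansion along the last d columns, the last one first: it is supported on the top
    row of those that are killed. *)
Lemma minor_of_peel d rs cs : (d <= n)%N -> size rs = size cs ->
  {in rs, forall r, r <= n - d}%N ->
  minor_of ext_entry (rs ++ itv (n - d).+1 n) (cs ++ itv n.+1 (n + d)) = minor_of ext_entry rs cs.
Proof.
elim: d => [|d IH] dn sz rd.
  by rewrite !itv_nil ?cats0 //; lia.
rewrite (@itv_cons (n - d.+1).+1); last by lia.
rewrite addnS (@itv_rcons n.+1); last by lia.
rewrite catA minor_of_unit_col; last 2 first.
- by rewrite !size_cat !size_itv sz; lia.
- move=> r; rewrite mem_cat mem_itv => /orP[/rd|] h; apply: ext_entry_zero; lia.
rewrite cats0; have -> : ((n - d.+1).+2 = (n - d).+1)%N by lia.
rewrite IH //; [|lia|by move=> r /rd; lia].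
have {1}-> : ((n - d.+1).+1 = n.*2.+1 - (n + d).+1)%N by lia.
rewrite ext_entry_unit; [|lia..].
rewrite -exprD -[RHS]mul1r; congr (_ * _).
rewrite size_cat size_itv sz -signr_odd.
by rewrite (_ : odd _ = false) ?expr0 //; lia.
Qed.

Lemma minor_peel i d cs : (d <= n)%N -> (i + size cs = (n - d).+1)%N ->
  {in cs, forall c, c <= n}%N ->
  minor X (itv i (n - d)) cs = minor_of ext_entry (itv i n) (cs ++ itv n.+1 (n + d)).
Proof.
move=> dn sz csn; rewrite minor_ext // (@itv_cat i (n - d) n); [|lia..].
rewrite minor_of_peel // ?size_itv; first by lia.
by move=> r; rewrite mem_itv; lia.
Qed.

(** Moving the last row from m to m + 1 is moving the last column one step to the right:
    this column kills row m + 1 before the move and row m after it. *)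
Lemma minor_peel_next i m cs : (0 < i <= m)%N -> (m < n)%N ->
  (i + size cs = m.+1)%N -> {in cs, forall c, c <= n}%N ->
  minor X (rcons (itv i m.-1) m.+1) cs
  = minor_of ext_entry (itv i n) (cs ++ rcons (itv n.+1 (n + (n - m)).-1) (n + (n - m)).+1).
Proof.
move=> im mn sz csn; rewrite minor_ext //.
rewrite (@itv_cat i m.-1 n); [|lia..].
rewrite (_ : m.-1.+1 = m); last by lia.
rewrite (@itv_cons m n); last by lia.
rewrite -!cats1 catA minor_of_unit_col; last 2 first.
- by rewrite !size_cat !size_itv; lia.
- by move=> r; rewrite mem_cat !mem_itv => h; apply: ext_entry_zero; lia.
have -> : ext_entry m (n + (n - m)).+1 = (-1) ^+ ((n + (n - m)).+1 - n.+1).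
  by rewrite -ext_entry_unit; [congr ext_entry; lia|lia..].
rewrite cats0 (@itv_cons m.+1 n); last by lia.
have hm : ((n - (n - m.+1)).+1 = m.+2)%N by lia.
have := @minor_of_peel (n - m.+1) (itv i m.-1 ++ [:: m.+1]) cs.
rewrite hm -catA /= => <-; last 3 first.
- by lia.
- by rewrite size_cat size_itv /=; lia.
- by move=> r; rewrite mem_cat mem_itv inE; lia.
have -> : ((n + (n - m)).-1 = n + (n - m.+1))%N by lia.
rewrite -exprD -[LHS]mul1r; congr (_ * _).
rewrite !size_cat !size_itv -signr_odd.
by rewrite (_ : odd _ = false) ?expr0 //; lia.
Qed.

End Extended.

(** * All variables as trailing minors of the extended matrix *)

Section Staircase.
Variables (R : comNzRingType) (n : nat) (X : 'M[R]_n).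
Implicit Types rs cs : seq nat.

Local Notation G := (minor_of (ext_entry X)).

Definition trail (i j : nat) : R := G (itv i n) (itv j (n + j - i)).

(** The value 0 below the last row makes [Phi] equal to the coefficient u there. *)
Definition trail_next (i j : nat) : R :=
  if (i <= n)%N then
    G (itv i n) (rcons (itv j (n + j - i).-1) (n + j - i).+1)
  else 0.

Lemma minor_of0 F cs : minor_of F [::] cs = 1 :> R.
Proof. by rewrite (@minor_ofE _ _ _ _ 0) ?det_mx00. Qed.

Lemma trail_bottom j : trail n.+1 j = 1.
Proof. by rewrite /trail itv_nil ?minor_of0. Qed.

Lemma trail_next_bottom j : trail_next n.+1 j = 0.
Proof. by rewrite /trail_next ltnn. Qed.

Lemma trail_right i : (0 < i)%N -> trail i n.+1 = 1.
Proof.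
move=> i0; case: (leqP i n) => hi; last first.
  by rewrite /trail itv_nil ?minor_of0.
have := @minor_of_peel _ _ X (n.+1 - i) [::] [::].
rewrite minor_of0 /trail /= => <- //; last by lia.
by congr (minor_of _ (itv _ _) (itv _ _)); lia.
Qed.

Lemma trail_next_right i : (0 < i)%N -> trail_next i n.+1 = 0.
Proof.
move=> i0; rewrite /trail_next; case: ifP => // hi.
rewrite (@itv_cons i n) // minor_of.unlock /=.
rewrite (expand_det_row _ ord0) big1 // => c _.
suff [h1 h2] : (n < nth 0%N (rcons (itv n.+1 (n + n.+1 - i).-1) (n + n.+1 - i).+1) c)%N
  /\ (i + nth 0%N (rcons (itv n.+1 (n + n.+1 - i).-1) (n + n.+1 - i).+1) c != n.*2.+1)%N.
  by rewrite mxE /= ext_entry_zero ?mul0r.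
have hc : (c < (n.+1 - i.+1).+1)%N by rewrite -size_itv ltn_ord.
move: (nat_of_ord c) hc => l hl.
rewrite nth_rcons size_itv; case: (ltnP l) => h; first by rewrite nth_iota; lia.
by rewrite ifT; lia.
Qed.

(** For i <= j the unit columns kill the rows [n + i - j + 1, n]. *)
Lemma f_trail i j : (0 < i <= n)%N -> (0 < j <= n)%N -> f X i j = trail i j.
Proof.
move=> hi hj; rewrite /f /trail /fblock /det_block.
case: leqP => ij /=; last first.
  by rewrite minor_ext //= => c; rewrite mem_itv; lia.
have := @minor_peel _ _ X i (j - i) (itv j n).
rewrite size_itv (_ : (n - (j - i) = n + i - j)%N); last by lia.
move=> ->; [|lia|lia|by move=> c; rewrite mem_itv; lia].
rewrite (@itv_cat j n (n + j - i)); [|lia..].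
by congr (minor_of _ _ (_ ++ itv _ _)); lia.
Qed.

Lemma f_right_trail i j : (j < i <= n)%N -> f_right X i j = trail_next i j.
Proof.
move=> hi; rewrite /f_right /trail_next /fblock leqNgt.
case/andP: hi => h1 h2; rewrite h1 h2 /= /det_right /=.
by rewrite minor_ext // => c; rewrite mem_rcons inE mem_itv; lia.
Qed.

Lemma f_down_trail i j : (0 < i < j)%N -> (j <= n)%N ->
  f_down X i j = trail_next i j.
Proof.
move=> hi hj; rewrite /f_down /trail_next /fblock.
rewrite (_ : (i <= j)%N); last by lia.
rewrite (_ : (i <= n)%N); last by lia.
rewrite /det_down /= minor_peel_next ?size_itv; [|lia..|by move=> c; rewrite mem_itv; lia].
rewrite (_ : n - (n + i - j) = j - i)%N; last by lia.
rewrite (@itv_cat j n (n + j - i).-1); [|lia..].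
by rewrite -rcons_cat; congr (minor_of _ _ (rcons (_ ++ itv _ _) _)); lia.
Qed.

Variables (alpha beta : nat).
Hypotheses (halpha : (1 <= alpha)%N) (hab : (alpha < beta)%N)
           (hbeta : (beta < n)%N).

Local Notation ph := (phi X alpha beta).
(** The variable phi_(1,beta+1) with its first column moved one step to the left, in both
    definitions of theta. *)
Definition w_theta : R :=
  if beta.*2 == n then psi1_star X alpha beta else f_left X 1 beta.+1.
(** The variable phi_(alpha+1,1) with its first row moved one step up, in both definitions
    of psi. *)
Definition w_psi : R :=
  if alpha.*2 == n then theta1_star X alpha beta else f_up X alpha.+1 1.

(** The two special diagonals are j - i = alpha - n and j - i = n - beta. *)
Definition coefs (i j : nat) : R * R :=
  if (i + alpha == n + j)%N then (ph (1, beta.+1)%N, w_theta)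
  else if (j + beta == n + i)%N then (ph (alpha.+1, 1)%N, w_psi)
  else (1, 0).

(** Also used for i = n + 1 and j = n + 1, where it gives the value that the exchange relations
    need at the positions outside the grid. *)
Definition Phi (i j : nat) : R :=
  trail i j * (coefs i j).1 - trail_next i j * (coefs i j).2.

Lemma Phi_generic i j : (i + alpha != n + j)%N -> (j + beta != n + i)%N ->
  Phi i j = trail i j.
Proof.
by move=> /negPf h1 /negPf h2; rewrite /Phi /coefs h1 h2 /= mulr1 mulr0 subr0.
Qed.

Lemma phi_f i j : (0 < i <= n)%N -> (0 < j <= n)%N ->
  (i + alpha != n + j)%N -> (j + beta != n + i)%N -> ph (i, j) = f X i j.
Proof. by move=> hi hj h1 h2; rewrite /phi; do 2 (rewrite ifF; last by lia). Qed.

Lemma phi_corner_theta : ph (1, beta.+1)%N =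
  if beta.*2 == n then psi_gen X alpha beta 1 else f X 1 beta.+1.
Proof.
rewrite /phi ifF; last by lia.
case: (altP (beta.*2 =P n)) => hb; last by rewrite ifF //; lia.
by rewrite ifT /psi ?ifF //; lia.
Qed.

Lemma phi_corner_psi : ph (alpha.+1, 1)%N =
  if alpha.*2 == n then theta_gen X alpha beta 1 else f X alpha.+1 1.
Proof.
rewrite /phi; case: (altP (alpha.*2 =P n)) => ha.
  by rewrite ifT /theta ?ifF //; lia.
by do 2 (rewrite ifF; last by lia).
Qed.

Lemma phiE i j : (0 < i <= n)%N -> (0 < j <= n)%N -> ph (i, j) = Phi i j.
Proof.
move=> hi hj; rewrite /Phi /coefs.
case: (altP (i + alpha =P n + j)%N) => h1.
  rewrite phi_corner_theta /w_theta /=.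
  rewrite ifT; last by lia.
  rewrite /theta /theta_gen (_ : (n + j - alpha = i)%N); last by lia.
  rewrite f_trail // f_right_trail; last by lia.
  by case: ifP.
case: (altP (j + beta =P n + i)%N) => h2; last first.
  by rewrite phi_f // f_trail // mulr1 mulr0 subr0.
rewrite phi_corner_psi /w_psi /=.
rewrite ifF; last by lia.
rewrite ifT; last by lia.
rewrite /psi /psi_gen (_ : (n + i - beta = j)%N); last by lia.
rewrite f_trail // f_down_trail; [|lia..].
by case: ifP.
Qed.

Lemma Phi_corner_theta : Phi n.+1 alpha.+1 = ph (1, beta.+1)%N.
Proof.
rewrite /Phi /coefs ifT; last by lia.
by rewrite trail_bottom trail_next_bottom mul1r mul0r subr0.
Qed.

Lemma Phi_corner_psi : Phi beta.+1 n.+1 = ph (alpha.+1, 1)%N.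
Proof.
rewrite /Phi /coefs ifF; last by lia.
rewrite ifT; last by lia.
by rewrite trail_right // trail_next_right // mul1r mul0r subr0.
Qed.

Lemma Phi_bottom j : (0 < j <= n.+1)%N -> j != alpha.+1 -> Phi n.+1 j = 1.
Proof.
by move=> hj ja; rewrite Phi_generic ?trail_bottom //; lia.
Qed.

Lemma Phi_right i : (0 < i <= n.+1)%N -> i != beta.+1 -> Phi i n.+1 = 1.
Proof.
by move=> hj ja; rewrite Phi_generic ?trail_right //; lia.
Qed.

End Staircase.

(** * Exchange relations of trailing minors *)

(** The relations below are all of the form u H - w H', for two determinantal identities
    H and H'. *)
Lemma eq_of_combination (R : comNzRingType) (u w a b a' b' l r : R) :
  a = b -> a' = b' -> l - r = u * (a - b) - w * (a' - b') -> l = r.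
Proof. by move=> -> ->; rewrite !subrr !mulr0 subr0 => /subr0_eq. Qed.

Section TrailExchange.
Variables (R : comNzRingType) (n : nat) (X : 'M[R]_n).

Local Notation G := (minor_of (ext_entry X)).
Local Notation T := (trail X).
Local Notation T' := (trail_next X).

Lemma trailE i j s : (i + s = n)%N -> T i j = G (itv i n) (itv j (j + s)).
Proof. by move=> h; congr (minor_of _ _ (itv _ _)); lia. Qed.

Lemma trail_nextE i j s : (i + s = n)%N -> (0 < j)%N ->
  T' i j = G (itv i n) (itv j (j + s).-1 ++ [:: (j + s).+1]).
Proof.
move=> h j0; rewrite /trail_next ifT; last by lia.
by rewrite -cats1; congr (minor_of _ _ (itv _ _ ++ [:: _])); lia.
Qed.

Lemma trail1 p a : p = n -> (0 < a)%N ->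
  (T p a = G [:: p] [:: a]) * (T' p a = G [:: p] [:: a.+1]).
Proof.
move=> pn a0; rewrite (@trailE p a 0) ?(@trail_nextE p a 0) ?addn0 //.
by rewrite -[in itv p n]pn !itv1 (@itv_nil a a.-1) //; lia.
Qed.

Lemma trail2 p a : p.+1 = n -> (0 < a)%N ->
  (T p a = G [:: p; p.+1] [:: a; a.+1])
  * (T' p a = G [:: p; p.+1] [:: a; a.+2]).
Proof.
move=> pn a0; rewrite (@trailE p a 1) ?(@trail_nextE p a 1) ?addn1 //=.
by rewrite -[in itv p n]pn /itv !subSn ?leqnSn // !subnn.
Qed.

(** In the last row the blocks one row further down are empty, and one Pluecker relation
    suffices. *)
Lemma exchange_diag_bottom p a u w : (0 < p)%N -> (0 < a)%N -> p.+1 = n ->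
  T p.+1 a.+2 * (T p a * u - T' p a * w) + T p.+1 a * T p a.+1 * u
    = (T p.+1 a.+1 * u - T' p.+1 a.+1 * w) * T' p a.
Proof.
move=> p0 a0 pn.
rewrite !(trail1 pn) // !(trail2 pn) //.
have /= H := @pluecker_front _ (ext_entry X) p [:: p.+1] [::] a a.+1 a.+2 erefl.
move: H; generalize_minors => H; ring: H.
Qed.

Lemma exchange_upper_bottom p a u w : (0 < p)%N -> (0 < a)%N -> p.+1 = n ->
  (T p.+1 a.+2 * u - T' p.+1 a.+2 * w) * T p a
  + T p.+1 a * (T p a.+1 * u - T' p a.+1 * w)
    = T p.+1 a.+1 * (G [:: p; p.+1] [:: a; a.+2] * u - G [:: p; p.+1] [:: a; a.+3] * w).
Proof.
move=> p0 a0 pn.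
rewrite !(trail1 pn) // !(trail2 pn) //.
have /= H := @pluecker_front _ (ext_entry X) p [:: p.+1] [::] a a.+1 a.+2 erefl.
have /= := @pluecker_front _ (ext_entry X) p [:: p.+1] [::] a a.+1 a.+3 erefl.
move: H; generalize_minors => H H'.
by apply: (@eq_of_combination R u w _ _ _ _ _ _ H H'); ring.
Qed.

Lemma exchange_lower_bottom p a u w : (0 < p)%N -> (0 < a)%N -> p.+1 = n ->
  T p.+1 a.+2 * u * T p a
  + (T p.+1 a * u - T' p.+1 a * w) * T p a.+1
    = T p.+1 a.+1 * (T' p a * u - T p a.+1 * w).
Proof.
move=> p0 a0 pn.
rewrite !(trail1 pn) // !(trail2 pn) //.
have /= := @pluecker_front _ (ext_entry X) p [:: p.+1] [::] a a.+1 a.+2 erefl.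
generalize_minors => H; ring: H.
Qed.

(** p and p + 1 are the first two rows of the largest block and S its other rows;
    a and a + 1 are its first two columns, y is its last one, and M consists of
    the columns in between. *)
Section Inner.
Variables p a s : nat.
Hypotheses (a0 : (0 < a)%N) (ns : (p + s.+2 = n)%N).

Let M := itv a.+2 (a + s).+1.
Let S := itv p.+2 n.
Let y := (a + s).+2.

Lemma size_inner : size S = (size M).+1.
Proof. by rewrite /S /M !size_itv; lia. Qed.

Lemma inner_rows : (itv p n = [:: p, p.+1 & S]) * (itv p.+1 n = p.+1 :: S).
Proof. by rewrite (@itv_cons p) ?(@itv_cons p.+1) //; lia. Qed.

Lemma inner_cols :
  (itv a.+2 y = M ++ [:: y])
  * (itv a.+1 y.-1 = a.+1 :: M) * (itv a.+1 y = a.+1 :: M ++ [:: y])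
  * (itv a y.-1 = [:: a, a.+1 & M]) * (itv a y = [:: a, a.+1 & M ++ [:: y]]).
Proof.
have e1 k : (a <= k)%N -> itv a k = a :: itv a.+1 k by exact: itv_cons.
have e2 k : (a < k)%N -> itv a.+1 k = a.+1 :: itv a.+2 k by exact: itv_cons.
have e3 : itv a.+2 y = M ++ [:: y] by rewrite /y itv_rcons //; lia.
by rewrite !e1 ?e2 ?e3 //=; rewrite /y /=; lia.
Qed.

Lemma inner_diag :
  (T p a = G [:: p, p.+1 & S] [:: a, a.+1 & M ++ [:: y]])
  * (T p.+1 a.+1 = G (p.+1 :: S) (a.+1 :: M ++ [:: y]))
  * (T p.+2 a.+2 = G S (M ++ [:: y]))
  * (T' p a = G [:: p, p.+1 & S] [:: a, a.+1 & M ++ [:: y.+1]])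
  * (T' p.+1 a.+1 = G (p.+1 :: S) (a.+1 :: M ++ [:: y.+1]))
  * (T' p.+2 a.+2 = G S (M ++ [:: y.+1])).
Proof.
rewrite !(@trailE p a s.+2) ?(@trailE _ a.+1 s.+1) ?(@trailE _ a.+2 s) //; try lia.
rewrite !(@trail_nextE p a s.+2) ?(@trail_nextE _ a.+1 s.+1) ?(@trail_nextE _ a.+2 s) //; try lia.
by rewrite ?(addSn, addnS) -/y /= !inner_rows ?inner_cols.
Qed.

Lemma inner_upper :
  (T p.+1 a.+2 = G (p.+1 :: S) (M ++ [:: y; y.+1]))
  * (T p a.+1 = G [:: p, p.+1 & S] (a.+1 :: M ++ [:: y; y.+1]))
  * (T' p.+1 a.+2 = G (p.+1 :: S) (M ++ [:: y; y.+2]))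
  * (T' p a.+1 = G [:: p, p.+1 & S] (a.+1 :: M ++ [:: y; y.+2])).
Proof.
rewrite !(@trailE _ a.+1 s.+2) ?(@trailE _ a.+2 s.+1) //; try lia.
rewrite !(@trail_nextE _ a.+1 s.+2) ?(@trail_nextE _ a.+2 s.+1) //; try lia.
rewrite ?(addSn, addnS) -/y /= !inner_rows.
rewrite (@itv_rcons a.+1 y) ?(@itv_rcons a.+2 y); try (rewrite /y; lia).
by rewrite ?inner_cols /= -!catA.
Qed.

Lemma inner_lower :
  (T p.+1 a = G (p.+1 :: S) [:: a, a.+1 & M]) * (T p.+2 a.+1 = G S (a.+1 :: M)).
Proof.
rewrite !(@trailE _ a s.+1) ?(@trailE _ a.+1 s) //; try lia.
by rewrite ?(addSn, addnS) -/y.-1 /= !inner_rows ?inner_cols.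
Qed.

Lemma inner_lower_next :
  (T' p.+1 a = G (p.+1 :: S) (a :: itv a.+1 (a + s) ++ [:: y]))
  * (T' p.+2 a.+1 = G S (itv a.+1 (a + s) ++ [:: y])).
Proof.
rewrite !(@trail_nextE _ a s.+1) ?(@trail_nextE _ a.+1 s) //; try lia.
rewrite ?(addSn, addnS) -/y /= !inner_rows.
by rewrite [itv a _]itv_cons ?leq_addr.
Qed.

(** Special middle diagonal: the relation for w is the relation for u with the last two
    columns y and y + 1 exchanged; the signs cancel, and both have the same
    quotient. *)
Lemma exchange_diag_inner u w :
  T p.+1 a.+2 * T p.+2 a.+1 * (T p a * u - T' p a * w)
  + T p.+1 a * T p a.+1 * (T p.+2 a.+2 * u - T' p.+2 a.+2 * w)
    = (T p.+1 a.+1 * u - T' p.+1 a.+1 * w)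
      * (T' p a * T p.+2 a.+2 - T p a * T' p.+2 a.+2).
Proof.
rewrite !inner_diag !inner_upper !inner_lower.
have H := exchange_minors (ext_entry X) p p.+1 a a.+1 y y.+1 size_inner.
have := exchange_minors (ext_entry X) p p.+1 a a.+1 y.+1 y size_inner.
have sw := minor_of_swap (ext_entry X) (rs := p.+1 :: S) (M := M) [::] y.+1 y.
have sw' := minor_of_swap (ext_entry X) (rs := [:: p, p.+1 & S]) (M := a.+1 :: M) [::] y.+1 y.
rewrite sw ?sw' /= ?size_inner; try lia.
move: H; generalize_minors => H H'.
by apply: (@eq_of_combination R u (- w) _ _ _ _ _ _ H H'); ring.
Qed.

(** Special upper diagonal: the column y + 1 of [exchange_minors] may be any column. *)
Lemma exchange_upper_inner u w : exists Q,
  (T p.+1 a.+2 * u - T' p.+1 a.+2 * w) * T p.+2 a.+1 * T p a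
  + T p.+1 a * (T p a.+1 * u - T' p a.+1 * w) * T p.+2 a.+2
    = T p.+1 a.+1 * Q.
Proof.
rewrite !inner_diag !inner_upper !inner_lower.
have H := exchange_minors (ext_entry X) p p.+1 a a.+1 y y.+1 size_inner.
have H' := exchange_minors (ext_entry X) p p.+1 a a.+1 y y.+2 size_inner.
set Q := (X in _ = _ * X) in H; set Q' := (X in _ = _ * X) in H'.
exists (u * Q - w * Q'); move: Q Q' H H' => Q Q'.
generalize_minors => H H'.
by apply: (@eq_of_combination R u w _ _ _ _ _ _ H H'); ring.
Qed.

(** Special lower diagonal: the relation for w is the relation for u with the columns y - 1
    and y exchanged. When M is empty the column y - 1 is a + 1, which
    [exchange_minors] does not allow to exchange; then a single Pluecker
    relation over the column y gives the relation for w. *)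
Lemma exchange_lower_inner u w : exists Q,
  T p.+1 a.+2 * (T p.+2 a.+1 * u - T' p.+2 a.+1 * w) * T p a
  + (T p.+1 a * u - T' p.+1 a * w) * T p a.+1 * T p.+2 a.+2
    = T p.+1 a.+1 * Q.
Proof.
rewrite !inner_diag !inner_upper !inner_lower !inner_lower_next.
have H := exchange_minors (ext_entry X) p p.+1 a a.+1 y y.+1 size_inner.
set Q := (X in _ = _ * X) in H; case: (posnP s) => s0.
  have M0 : M = [::] by rewrite /M itv_nil // s0 addn0.
  have := @pluecker_front _ (ext_entry X) p (p.+1 :: S) [:: y] a a.+1 y.+1.
  rewrite /= size_inner M0 => /(_ erefl) H'.
  have sw := minor_of_swap (ext_entry X) (rs := p.+1 :: S) (M := [::]) [::] y a.+1.
  have sw' := minor_of_swap (ext_entry X) (rs := [:: p, p.+1 & S]) (M := [::]) [:: y.+1] y a.+1.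
  have sw2 := minor_of_swap (ext_entry X) (rs := [:: p, p.+1 & S]) (M := [:: a]) [::] y a.+1.
  rewrite /= size_inner M0 /= in sw sw' sw2.
  rewrite sw ?sw' ?sw2 // in H'.
  rewrite itv_nil ?s0 ?addn0 // M0 /= in H *.
  set g := G S [:: y] in H *.
  exists (u * Q - w * (g * G [:: p, p.+1 & S] [:: a; y; y.+1])).
  move: g Q H H' => g Q; generalize_minors => H H'.
  by apply: (@eq_of_combination R u (- (w * g)) _ _ _ _ _ _ H H'); ring.
pose M' := itv a.+2 (a + s).
have MM' : M = M' ++ [:: y.-1] by rewrite /M itv_rcons //; lia.
have -> : itv a.+1 (a + s) = a.+1 :: M' by rewrite itv_cons //; lia.
have sM : size S = (size (M' ++ [:: y])).+1.
  by rewrite size_inner MM' !size_cat.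
have := exchange_minors (ext_entry X) p p.+1 a a.+1 y.-1 y.+1 sM.
have sz : size S = (size M').+2 by rewrite sM size_cat addn1.
rewrite !MM' -?catA ?cat_cons -?catA /= in H *.
have sw1 rs N : (size M' + 2 <= size rs)%N ->
    G rs (M' ++ [:: y, y.-1 & N]) = - G rs (M' ++ [:: y.-1, y & N]).
  exact: minor_of_swap.
have sw2 rs N : (size M' + 3 <= size rs)%N ->
    G rs (a.+1 :: M' ++ [:: y, y.-1 & N]) = - G rs (a.+1 :: M' ++ [:: y.-1, y & N]).
  by move=> h; rewrite -!cat_cons minor_of_swap //=; lia.
have sw3 rs N : (size M' + 4 <= size rs)%N ->
    G rs [:: a, a.+1 & M' ++ [:: y, y.-1 & N]]
    = - G rs [:: a, a.+1 & M' ++ [:: y.-1, y & N]].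
  by move=> h; rewrite -!cat_cons minor_of_swap //=; lia.
rewrite !sw1 ?sw2 ?sw3 /= ?sz; try lia.
set Q' := (X in _ = _ * X) => H'.
exists (u * Q + w * Q'); move: Q Q' H H' => Q Q'.
generalize_minors => H H'.
by apply: (@eq_of_combination R u w _ _ _ _ _ _ H H'); ring.
Qed.

End Inner.

End TrailExchange.

(** * Exchange relations of the cluster variables *)

Section PhiExchange.
Variables (R : comNzRingType) (n : nat) (X : 'M[R]_n).

Local Notation G := (minor_of (ext_entry X)).
Local Notation T := (trail X).
Local Notation T' := (trail_next X).

Lemma exchange_diag p a u w : (0 < p)%N -> (0 < a)%N -> (p < n)%N ->
  exists Q, T p.+1 a.+2 * T p.+2 a.+1 * (T p a * u - T' p a * w)
    + T p.+1 a * T p a.+1 * (T p.+2 a.+2 * u - T' p.+2 a.+2 * w)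
    = (T p.+1 a.+1 * u - T' p.+1 a.+1 * w) * Q.
Proof.
move=> p0 a0 pn; have [pn1|pn1] := ltnP p.+1 n.
  have ns : (p + (n - p.+2).+2 = n)%N by lia.
  by eexists; exact: (exchange_diag_inner X a0 ns).
have e : p.+1 = n by lia.
exists (T' p a); rewrite -(exchange_diag_bottom X u w p0 a0 e).
by rewrite [p.+2](congr1 succn e) !trail_bottom trail_next_bottom mulr1 mul1r mul0r subr0.
Qed.

Lemma exchange_upper p a u w : (0 < p)%N -> (0 < a)%N -> (p < n)%N ->
  exists Q, (T p.+1 a.+2 * u - T' p.+1 a.+2 * w) * T p.+2 a.+1 * T p a
    + T p.+1 a * (T p a.+1 * u - T' p a.+1 * w) * T p.+2 a.+2
    = T p.+1 a.+1 * Q.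
Proof.
move=> p0 a0 pn; have [pn1|pn1] := ltnP p.+1 n.
  have ns : (p + (n - p.+2).+2 = n)%N by lia.
  exact: (exchange_upper_inner X a0 ns).
have e : p.+1 = n by lia.
eexists; etransitivity; last exact: (exchange_upper_bottom X u w p0 a0 e).
by rewrite [p.+2](congr1 succn e) !trail_bottom !mulr1.
Qed.

Lemma exchange_lower p a u w : (0 < p)%N -> (0 < a)%N -> (p < n)%N ->
  exists Q, T p.+1 a.+2 * (T p.+2 a.+1 * u - T' p.+2 a.+1 * w) * T p a
    + (T p.+1 a * u - T' p.+1 a * w) * T p a.+1 * T p.+2 a.+2
    = T p.+1 a.+1 * Q.
Proof.
move=> p0 a0 pn; have [pn1|pn1] := ltnP p.+1 n.
  have ns : (p + (n - p.+2).+2 = n)%N by lia.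
  exact: (exchange_lower_inner X a0 ns).
have e : p.+1 = n by lia.
eexists; etransitivity; last exact: (exchange_lower_bottom X u w p0 a0 e).
by rewrite [p.+2](congr1 succn e) !trail_bottom trail_next_bottom mulr1 mul1r mul0r subr0.
Qed.

Variables (alpha beta : nat).
Hypotheses (halpha : (1 <= alpha)%N) (hab : (alpha < beta)%N)
           (hbeta : (beta < n)%N).

Local Notation Ph := (Phi X alpha beta).
Local Notation co := (coefs X alpha beta).

Lemma coefsS i j : co i.+1 j.+1 = co i j.
Proof. by rewrite /coefs !(addSn, addnS) !eqSS. Qed.

Lemma coefs_generic i j :
  (i + alpha != n + j)%N -> (j + beta != n + i)%N -> co i j = (1, 0).
Proof. by move=> /negPf h1 /negPf h2; rewrite /coefs h1 h2. Qed.

(** The special diagonals are far apart: their difference 2n - alpha - beta is at least 3. *)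
Lemma coefs_near i j : [\/ co i j.+1 = (1, 0) /\ co i.+1 j = (1, 0),
    co i j = (1, 0) /\ co i j.+1 = (1, 0)
  | co i j = (1, 0) /\ co i.+1 j = (1, 0)].
Proof.
case: (altP (i + alpha =P n + j)%N) => h1.
  by constructor 1; rewrite !coefs_generic //; lia.
case: (altP (j + beta =P n + i)%N) => h2.
  by constructor 1; rewrite !coefs_generic //; lia.
rewrite (coefs_generic h1 h2).
case: (altP (i + alpha =P n + j.+1)%N) => h3.
  by constructor 3; rewrite !coefs_generic //; lia.
case: (altP (j.+1 + beta =P n + i)%N) => h4.
  by constructor 3; rewrite !coefs_generic //; lia.
by constructor 2; rewrite !coefs_generic //; lia.
Qed.

(** The six neighbours lie on the diagonals j - i - 1, j - i and j - i + 1, and each product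
    has exactly one factor on each of them. *)
Lemma Phi_exchange p a : (0 < p)%N -> (0 < a)%N -> (p < n)%N ->
  exists Q, Ph p.+1 a.+2 * Ph p.+2 a.+1 * Ph p a
    + Ph p.+1 a * Ph p a.+1 * Ph p.+2 a.+2 = Ph p.+1 a.+1 * Q.
Proof.
move=> p0 a0 pn; rewrite /Phi !coefsS.
case: (coefs_near p a) => -[-> ->] /=; rewrite !mulr1 !mulr0 !subr0.
- exact: exchange_diag.
- exact: exchange_lower.
- exact: exchange_upper.
Qed.

Lemma f_left_ext : f_left X 1 beta.+1 = G (itv 1 n) (beta :: itv beta.+2 (n + beta)).
Proof.
rewrite /f_left /fblock /det_left /= (_ : n + 1 - beta.+1 = n - beta)%N; last by lia.
rewrite minor_peel; [|lia|by rewrite /= size_itv; lia|].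
  by rewrite /= -itv_cat //; lia.
by move=> c; rewrite inE mem_itv; lia.
Qed.

Lemma psi1_star_ext : beta.*2 = n -> psi1_star X alpha beta =
  G (itv 1 n) (beta :: itv beta.+2 (n + beta)) * f X alpha.+1 1
  - G (itv 1 n) (beta :: itv beta.+2 (n + beta).-1 ++ [:: (n + beta).+1]) * f_up X alpha.+1 1.
Proof.
move=> nb; rewrite /psi1_star -f_left_ext; congr (_ * _ - _ * _).
  rewrite /f_left /fblock /det_left /=; congr (minor _ (itv _ _) _); lia.
rewrite minor_peel_next ?size_itv; [|lia|lia|by rewrite /= size_itv; lia|].
  rewrite (_ : n - beta = beta)%N; last by lia.
  rewrite -cats1 /= catA -itv_cat //; lia.
by move=> c; rewrite inE mem_itv; lia.
Qed.

Lemma f_up_ext : f_up X alpha.+1 1 = G (alpha :: itv alpha.+2 n) (itv 1 (n - alpha)).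
Proof.
rewrite /f_up /fblock ltnS leqn0 gtn_eqF //= /det_up /= -minor_ext; last first.
  by move=> c; rewrite mem_itv; lia.
by congr (minor _ _ (itv _ _)); lia.
Qed.

Lemma theta1_star_ext : alpha.*2 = n -> theta1_star X alpha beta =
  G (alpha :: itv alpha.+2 n) (itv 1 (n - alpha)) * f X 1 beta.+1
  - G (alpha :: itv alpha.+2 n) (itv 1 (n - alpha).-1 ++ [:: (n - alpha).+1])
    * f_left X 1 beta.+1.
Proof.
move=> na; rewrite /theta1_star -cats1 !minor_ext.
- by rewrite (_ : n - alpha = alpha)%N ?subn1 //; lia.
- by move=> c; rewrite mem_cat inE mem_itv; lia.
- by move=> c; rewrite mem_itv; lia.
Qed.

(** Modulo phi_(1,beta+1), the exchange polynomial at (1, beta + 1) is this difference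
    times - f_(n,alpha+1). Either no diagonal involved is special, or one of the
    diagonals of (1, beta + 1) and (1, beta) is the diagonal of the psi_m; then
    both sides are linear in the pair attached to that diagonal. *)
Lemma corner_theta_exchange : exists Q,
  w_theta X alpha beta * Ph 2 beta.+1 - Ph 1 beta * Ph 2 beta.+2
  = phi X alpha beta (1, beta.+1)%N * Q.
Proof.
pose s := (n - 2)%N; have ns : (0 + s.+2 = n)%N by lia.
have b0 : (0 < beta)%N by lia.
rewrite (@phiE _ _ X _ _ halpha hab hbeta 1 beta.+1) //; [|lia..].
rewrite /Phi !coefsS /w_theta.
have yE : (n + beta = (beta + s).+2)%N by lia.
have sS := size_inner b0 ns.
have L y := left_shift_minors (ext_entry X) 1 beta beta.+1 y sS.
have H := L (beta + s).+2.
rewrite !(inner_diag X b0 ns) !(inner_lower X b0 ns).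
case: (altP (beta.*2 =P n)) => nb.
  have e0 : co 0 beta = (f X alpha.+1 1, f_up X alpha.+1 1).
    rewrite /coefs ifF ?ifT /w_psi ?phi_corner_psi //; [|lia..].
    by rewrite !ifF //; lia.
  have e1 : co 1 beta = (1, 0) by rewrite coefs_generic //; lia.
  rewrite e0 e1 psi1_star_ext //= !mulr1 !mulr0 !subr0 yE.
  rewrite (inner_cols b0 ns) (@itv_cons 1) /=; last by lia.
  have H' := L (beta + s).+3.
  move: (f X _ _) (f_up X _ _) => u w.
  exists (G (itv 2 n) (beta :: itv beta.+2 (beta + s).+1)).
  move: H H'; generalize_minors => H H'.
  by apply: (@eq_of_combination R u w _ _ _ _ _ _ H H'); ring.
(* The diagonal of (1, beta) is special or not; (u, w) is its pair. *)
have -> : co 0 beta = (1, 0) by rewrite coefs_generic //; lia.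
rewrite f_left_ext yE (inner_cols b0 ns) (@itv_cons 1) /=; last by lia.
rewrite !mulr1 !mulr0 !subr0.
rewrite !(inner_lower_next X b0 ns).
move: (co 1 beta) => [u w] /=.
pose M' := itv beta.+2 (beta + s).
have MM' : itv beta.+2 (beta + s).+1 = M' ++ [:: (beta + s).+1].
  by rewrite itv_rcons //; lia.
have -> : itv beta.+1 (beta + s) = beta.+1 :: M' by rewrite itv_cons //; lia.
have sM : size (itv 2 n) = (size (M' ++ [:: (beta + s).+2])).+1.
  by rewrite sS MM' !size_cat.
have sz : size (itv 2 n) = (size M').+2 by rewrite sM size_cat addn1.
have := left_shift_minors (ext_entry X) 1 beta beta.+1 (beta + s).+1 sM.
rewrite !MM' -?catA ?cat_cons -?catA /= in H *.
have sw1 rs N x y : (size M' + 2 <= size rs)%N ->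
    G rs (M' ++ [:: x, y & N]) = - G rs (M' ++ [:: y, x & N]).
  exact: minor_of_swap.
have sw2 rs c N x y : (size M' + 3 <= size rs)%N ->
    G rs (c :: M' ++ [:: x, y & N]) = - G rs (c :: M' ++ [:: y, x & N]).
  by move=> h; rewrite -!cat_cons minor_of_swap //=; lia.
rewrite [G _ (M' ++ [:: _; (beta + s).+1])]sw1 ?sz //; last by lia.
rewrite ![G _ (_ :: M' ++ [:: (beta + s).+2; _])]sw2 /= ?sz; try lia.
move=> H'.
exists (u * G (itv 2 n) (beta :: M' ++ [:: (beta + s).+1])
      - w * G (itv 2 n) (beta :: M' ++ [:: (beta + s).+2])).
move: H H'; generalize_minors => H H'.
by apply: (@eq_of_combination R u (- w) _ _ _ _ _ _ H H'); ring.
Qed.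

(** Counterpart of [corner_theta_exchange] at (alpha + 1, 1). The modified minor now has a
    moved row instead of a moved column, whence [desnanot]. *)
Lemma corner_psi_exchange : exists Q,
  w_psi X alpha beta * Ph alpha.+1 2 - Ph alpha 1 * Ph alpha.+2 2
  = phi X alpha beta (alpha.+1, 1)%N * Q.
Proof.
rewrite (@phiE _ _ X _ _ halpha hab hbeta alpha.+1 1) //; [|lia..].
rewrite /Phi !coefsS /w_psi.
pose s := (n - alpha - 2)%N; have sE : (n = alpha + s + 2)%N by lia.
pose M := itv 2 s.+2.
have hS : size (itv alpha.+2 n) = size M by rewrite !size_itv; lia.
have hb : alpha.+1 != alpha by lia.
have hbS : alpha.+1 \notin itv alpha.+2 n by rewrite mem_itv; lia.
have L y := desnanot (ext_entry X) 1 y hS hb hbS.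
have rw1 : itv alpha.+1 n = alpha.+1 :: itv alpha.+2 n by rewrite itv_cons //; lia.
have rw0 : itv alpha n = [:: alpha, alpha.+1 & itv alpha.+2 n].
  by rewrite itv_cons ?rw1 //; lia.
have c1 : itv 1 s.+2 = 1%N :: M by rewrite itv_cons.
have c2 : itv 2 s.+3 = M ++ [:: s.+3] by rewrite itv_rcons.
rewrite !(@trailE _ _ X alpha _ s.+2) ?(@trailE _ _ X alpha.+1 _ s.+1)
  ?(@trailE _ _ X alpha.+2 _ s); try lia.
rewrite !(@trail_nextE _ _ X alpha _ s.+2) ?(@trail_nextE _ _ X alpha.+1 _ s.+1)
  ?(@trail_nextE _ _ X alpha.+2 _ s) //; try lia.
rewrite !(add1n, add2n) !succnK rw1 rw0 c2 (@itv_cons 1 s.+3) // c2 c1.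
pose M' := itv 2 s.+1.
have c3 : itv 1 s.+1 = 1%N :: M' by rewrite itv_cons.
have MM' : M = M' ++ [:: s.+2] by rewrite /M itv_rcons.
rewrite c3 -/M -/M'; clearbody M' M.
have nE : (n - alpha = s.+2)%N by lia.
have H := L s.+3.
case: (altP (alpha.*2 =P n)) => na.
  have -> : co alpha 0 = (f X 1 beta.+1, f_left X 1 beta.+1).
    rewrite /coefs ifT /w_theta ?phi_corner_theta //; last by lia.
    by rewrite !ifF //; lia.
  have -> : co alpha 1 = (1, 0) by rewrite coefs_generic //; lia.
  rewrite theta1_star_ext // nE c1 succnK c3 /= !mulr1 !mulr0 !subr0.
  move: (f X _ _) (f_left X _ _) => u w.
  have hS' : size (itv alpha.+2 n) = size (M' ++ [:: s.+3]).
    by rewrite hS MM' !size_cat.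
  have sz : size (itv alpha.+2 n) = (size M').+1 by rewrite hS' size_cat addn1.
  have := desnanot (ext_entry X) 1 s.+2 hS' hb hbS.
  rewrite !MM' -?catA ?cat_cons -?catA /= in H *.
  have sw1 rs N x y : (size M' + 2 <= size rs)%N ->
      G rs (M' ++ [:: x, y & N]) = - G rs (M' ++ [:: y, x & N]).
    exact: minor_of_swap.
  have sw2 rs c N x y : (size M' + 3 <= size rs)%N ->
      G rs (c :: M' ++ [:: x, y & N]) = - G rs (c :: M' ++ [:: y, x & N]).
    by move=> h; rewrite -!cat_cons minor_of_swap //=; lia.
  rewrite ![G _ (M' ++ [:: s.+3; _])]sw1 ?sz //= ?sz; try lia.
  rewrite ![G _ (_ :: M' ++ [:: s.+3; _])]sw2 /= ?sz; try lia.
  move=> H'; exists (G (alpha :: itv alpha.+2 n) (M' ++ [:: s.+2; s.+3])).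
  move: H H'; generalize_minors => H H'.
  by apply: (@eq_of_combination R u (- w) _ _ _ _ _ _ H H'); ring.
(* The diagonal of (alpha, 1) is special or not; (u, w) is its pair. *)
have -> : co alpha 0 = (1, 0) by rewrite coefs_generic //; lia.
rewrite f_up_ext nE c1 /= !mulr1 !mulr0 !subr0.
have H' := L s.+4.
move: (co alpha 1) => [u w] /=.
exists (u * G (alpha :: itv alpha.+2 n) (M ++ [:: s.+3])
      - w * G (alpha :: itv alpha.+2 n) (M ++ [:: s.+4])).
move: H H'; generalize_minors => H H'.
by apply: (@eq_of_combination R u w _ _ _ _ _ _ H H'); ring.
Qed.

End PhiExchange.

(** * Neighbours in the quiver *)

Arguments phi : simpl never.

Section Neighbours.
Variables (R : comNzRingType) (n : nat) (X : 'M[R]_n).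

Definition in_grid (v : vertex) : bool :=
  (0 < v.1 <= n)%N && (0 < v.2 <= n)%N.

Lemma lbl_inj : injective (@lbl n).
Proof. by move=> [i j] [k l] [/val_inj -> /val_inj ->]. Qed.

Lemma mem_lbl v : (v \in [seq lbl q | q <- index_enum ('I_n * 'I_n)%type]) = in_grid v.
Proof.
apply/mapP/idP => [[[i j] _ ->]|].
  by rewrite /in_grid /=; have := ltn_ord i; have := ltn_ord j; lia.
case: v => i j /andP[/= hi hj].
have hi' : (i.-1 < n)%N by lia.
have hj' : (j.-1 < n)%N by lia.
exists (Ordinal hi', Ordinal hj'); first exact: mem_index_enum.
by congr (_, _) => /=; lia.
Qed.

Lemma prod_vertices (P : pred vertex) (L : seq vertex) (F : vertex -> R) :
  uniq L -> (forall v, (v \in L) = P v && in_grid v) ->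
  \prod_(q : 'I_n * 'I_n | P (lbl q)) F (lbl q) = \prod_(v <- L) F v.
Proof.
move=> uL mL; rewrite -(big_map (@lbl n) P F) -big_filter; apply: perm_big.
apply: uniq_perm => //.
  by rewrite filter_uniq // (map_inj_uniq lbl_inj) index_enum_uniq.
by move=> v; rewrite mem_filter mem_lbl mL.
Qed.

Variables (alpha beta : nat).
Hypotheses (halpha : (1 <= alpha)%N) (hab : (alpha < beta)%N)
           (hbeta : (beta < n)%N).

Local Notation Ph := (Phi X alpha beta).
Local Notation ph := (phi X alpha beta).
Local Notation arr := (arrow n alpha beta).

(** What stands for a position outside the grid: the extra arrows make (n+1, alpha+1) and
    (beta+1, n+1) aliases of the two mutable border vertices. *)
Definition wrap (v : vertex) : seq vertex :=
  if (v.1 <= n)%N && (v.2 <= n)%N then [:: v]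
  else if v == (n.+1, alpha.+1) then [:: (1%N, beta.+1)]
  else if v == (beta.+1, n.+1) then [:: (alpha.+1, 1%N)]
  else [::].

Lemma prod_wrap i j : (0 < i <= n.+1)%N -> (0 < j <= n.+1)%N ->
  \prod_(v <- wrap (i, j)) ph v = Ph i j.
Proof.
move=> hi hj; rewrite /wrap /=; case: ifP => h.
  by rewrite big_seq1 phiE //; lia.
rewrite !xpair_eqE; case: ifP => [/andP[/eqP-> /eqP->]|h1].
  by rewrite big_seq1 Phi_corner_theta.
case: ifP => [/andP[/eqP-> /eqP->]|h2].
  by rewrite big_seq1 Phi_corner_psi.
rewrite big_nil; have [e|e] := eqVneq i n.+1.
  by rewrite e Phi_bottom //; lia.
have -> : j = n.+1 by lia.
by rewrite Phi_right //; lia.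
Qed.

Lemma mem_wrap v w : (w \in wrap v) =
  [|| [&& v.1 <= n, v.2 <= n & w == v]%N,
      (v == (n.+1, alpha.+1)) && (w == (1%N, beta.+1))
    | (v == (beta.+1, n.+1)) && (w == (alpha.+1, 1%N))].
Proof.
case: v => i j; rewrite /wrap /= andbA; case: ifP => [/andP[hi hj]|_].
  have /negPf e1 : i != n.+1 by lia.
  have /negPf e2 : j != n.+1 by lia.
  by rewrite !xpair_eqE e1 e2 andbF /= orbF inE.
case: eqP => [[-> ->]|_] /=; last by case: ifP => _; rewrite ?inE.
have /negPf e1 : alpha.+1 != n.+1 by lia.
by rewrite !xpair_eqE e1 andbF orbF inE.
Qed.

Lemma arrow_out i j v : (1 < i)%N -> (1 < j)%N ->
  arr (i, j) v = [|| v == (i, j.+1), v == (i.+1, j), v == (i.-1, j.-1),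
    ((i, j) == (n, alpha.+1)) && (v == (1%N, beta.+1))
  | ((i, j) == (beta.+1, n)) && (v == (alpha.+1, 1%N))].
Proof.
move=> hi hj; rewrite /arrow /grid_arrow /extra_arrows /on_border !inE /=.
have /negPf-> : i != 1%N by lia.
have /negPf-> : j != 1%N by lia.
have ei k : ((i, j) == (k, 1%N)) = false by rewrite xpair_eqE; lia.
have ej k : ((i, j) == (1%N, k)) = false by rewrite xpair_eqE; lia.
rewrite andbT.
have -> : ((i, j) == (v.1.+1, v.2.+1)) = (v == (i.-1, j.-1)).
  by case: v => x y; rewrite !xpair_eqE /=; lia.
have e (a b c d : vertex) : ((a, b) == (c, d)) = (a == c) && (b == d) by [].
by rewrite !e !ei !ej /= -!orbA orbF.
Qed.

Lemma arrow_in i j v : (1 < i)%N -> (1 < j)%N ->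
  arr v (i, j) = [|| v == (i, j.-1), v == (i.-1, j), v == (i.+1, j.+1),
    ((i, j) == (n, alpha)) && (v == (1%N, beta.+1))
  | ((i, j) == (beta, n)) && (v == (alpha.+1, 1%N))].
Proof.
move=> hi hj; rewrite /arrow /grid_arrow /extra_arrows /on_border !inE /=.
have /negPf-> : i != 1%N by lia.
have /negPf-> : j != 1%N by lia.
have ei k : ((i, j) == (k, 1%N)) = false by rewrite xpair_eqE; lia.
have ej k : ((i, j) == (1%N, k)) = false by rewrite xpair_eqE; lia.
rewrite andbF andbT.
have -> : ((i, j) == (v.1, v.2.+1)) = (v == (i, j.-1)).
  by case: v => x y; rewrite !xpair_eqE /=; lia.
have -> : ((i, j) == (v.1.+1, v.2)) = (v == (i.-1, j)).
  by case: v => x y; rewrite !xpair_eqE /=; lia.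
have e (a b c d : vertex) : ((a, b) == (c, d)) = (b == d) && (a == c).
  by rewrite andbC.
by rewrite !e !ei !ej /= -!orbA.
Qed.

Lemma eq_in_grid v w : (v == w) && in_grid v = in_grid w && (v == w).
Proof. by case: eqP => [->|]; rewrite ?andbT ?andbF. Qed.

Lemma eq_in_grid_if b v w :
  b && (v == w) && in_grid v = b && (in_grid w && (v == w)).
Proof. by rewrite -eq_in_grid andbA. Qed.

Lemma wrap_in_grid v : in_grid v -> wrap v = [:: v].
Proof. by case/andP=> h1 h2; rewrite /wrap ifT //; lia. Qed.

Lemma wrap_below i j v : (0 < i <= n)%N -> (0 < j <= n)%N ->
  (v \in wrap (i.+1, j))
  = (i < n)%N && (v == (i.+1, j))
    || ((i, j) == (n, alpha.+1)) && (v == (1%N, beta.+1)).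
Proof.
move=> hi hj; rewrite mem_wrap /= !xpair_eqE eqSS.
have -> : (j == n.+1) = false by lia.
by rewrite andbF /= orbF; have -> : (j <= n)%N by lia.
Qed.

Lemma wrap_beside i j v : (0 < i <= n)%N -> (0 < j <= n)%N ->
  (v \in wrap (i, j.+1))
  = (j < n)%N && (v == (i, j.+1))
    || ((i, j) == (beta.+1, n)) && (v == (alpha.+1, 1%N)).
Proof.
move=> hi hj; rewrite mem_wrap /= !xpair_eqE eqSS.
have -> : (i == n.+1) = false by lia.
by rewrite /=; have -> : (i <= n)%N by lia.
Qed.

Lemma wrap_diag i j v : (0 < i <= n)%N -> (0 < j <= n)%N ->
  (v \in wrap (i.+1, j.+1))
  = [|| (i < n)%N && ((j < n)%N && (v == (i.+1, j.+1))),
    ((i, j) == (n, alpha)) && (v == (1%N, beta.+1))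
  | ((i, j) == (beta, n)) && (v == (alpha.+1, 1%N))].
Proof. by move=> hi hj; rewrite mem_wrap /= !xpair_eqE !eqSS. Qed.

Lemma corner_theta_in_grid : in_grid (1%N, beta.+1).
Proof. by rewrite /in_grid /=; lia. Qed.

Lemma corner_psi_in_grid : in_grid (alpha.+1, 1%N).
Proof. by rewrite /in_grid /=; lia. Qed.

Lemma uniq_wrap v : uniq (wrap v).
Proof. by rewrite /wrap; do 3 case: ifP => //. Qed.

Lemma prod_out i j : (1 < i <= n)%N -> (1 < j <= n)%N ->
  \prod_(q : 'I_n * 'I_n | arr (i, j) (lbl q)) ph (lbl q)
  = Ph i j.+1 * Ph i.+1 j * Ph i.-1 j.-1.
Proof.
move=> hi hj.
rewrite (@prod_vertices _ (wrap (i, j.+1) ++ wrap (i.+1, j) ++ wrap (i.-1, j.-1))).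
- by rewrite !big_cat /= !prod_wrap ?mulrA //; lia.
- rewrite [wrap (i.-1, _)]wrap_in_grid; last by rewrite /in_grid /=; lia.
  rewrite !cat_uniq !uniq_wrap /= orbF andbT.
  apply/andP; split.
    apply/hasPn => v; rewrite mem_cat inE wrap_below ?wrap_beside; [|lia..].
    case: v => x y; rewrite !xpair_eqE; lia.
  rewrite wrap_below; [|lia..]; rewrite !xpair_eqE; lia.
move=> v; rewrite !mem_cat arrow_out; [|lia..].
rewrite wrap_below ?wrap_beside; [|lia..].
rewrite wrap_in_grid; last by rewrite /in_grid /=; lia.
rewrite inE !andb_orl !eq_in_grid !eq_in_grid_if corner_theta_in_grid corner_psi_in_grid.
have -> : in_grid (i, j.+1) = (j < n)%N by rewrite /in_grid /=; lia.
have -> : in_grid (i.+1, j) = (i < n)%N by rewrite /in_grid /=; lia.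
have -> : in_grid (i.-1, j.-1) by rewrite /in_grid /=; lia.
by rewrite /=; do 5 (case: (_ && _); rewrite ?orbT ?orbF //=).
Qed.

Lemma prod_in i j : (1 < i <= n)%N -> (1 < j <= n)%N ->
  \prod_(q : 'I_n * 'I_n | arr (lbl q) (i, j)) ph (lbl q)
  = Ph i j.-1 * Ph i.-1 j * Ph i.+1 j.+1.
Proof.
move=> hi hj; have h1 : in_grid (i, j.-1) by rewrite /in_grid /=; lia.
have h2 : in_grid (i.-1, j) by rewrite /in_grid /=; lia.
rewrite (@prod_vertices (fun q => arr q (i, j))
  (wrap (i, j.-1) ++ wrap (i.-1, j) ++ wrap (i.+1, j.+1))).
- by rewrite !big_cat /= !prod_wrap ?mulrA //; lia.
- rewrite (wrap_in_grid h1) (wrap_in_grid h2) /= uniq_wrap !inE !wrap_diag; [|lia..].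
  by rewrite !xpair_eqE; lia.
move=> v; rewrite !mem_cat arrow_in; [|lia..].
rewrite (wrap_in_grid h1) (wrap_in_grid h2) wrap_diag; [|lia..].
rewrite !inE !andb_orl !eq_in_grid !eq_in_grid_if corner_theta_in_grid corner_psi_in_grid.
have -> : in_grid (i.+1, j.+1) = (i < n)%N && (j < n)%N by rewrite /in_grid /=; lia.
by rewrite h1 h2 /= andbA.
Qed.

Lemma extra_pairE (a b c d : vertex) : ((a, b) == (c, d)) = (a == c) && (b == d).
Proof. by []. Qed.

Lemma vertex_neq i j k l : (i != k) || (j != l) -> ((i, j) == (k, l) :> vertex) = false.
Proof. by rewrite xpair_eqE; case: eqP => //= _ /negPf. Qed.

Lemma corner_theta_out v : arr (1%N, beta.+1) v && in_grid v
  = (v \in [:: (n, alpha); (2, beta.+1)]).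
Proof.
rewrite /arrow /extra_arrows !inE !extra_pairE.
do 3 (rewrite (@vertex_neq 1 beta.+1); last by lia); rewrite eqxx.
do 2 (rewrite (@vertex_neq 1 beta.+1); last by lia).
case: v => x y; rewrite /grid_arrow /on_border /in_grid /= !xpair_eqE /= orbF.
lia.
Qed.

Lemma corner_theta_in v : arr v (1%N, beta.+1) && in_grid v
  = (v \in [:: (1%N, beta); (n, alpha.+1)] ++ wrap (2, beta.+2)).
Proof.
rewrite /arrow /extra_arrows mem_cat mem_wrap !inE !extra_pairE.
do ? [rewrite eqxx | rewrite (@vertex_neq 1 beta.+1); last by lia].
rewrite !andbF !andbT.
do 2 (rewrite (@vertex_neq 2 beta.+2); last by lia).
case: v => x y; rewrite /grid_arrow /on_border /in_grid /= !xpair_eqE /= !orbF.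
lia.
Qed.

Lemma corner_psi_out v : arr (alpha.+1, 1%N) v && in_grid v
  = (v \in [:: (beta, n); (alpha.+1, 2)]).
Proof.
rewrite /arrow /extra_arrows !inE !extra_pairE.
do ? [rewrite eqxx | rewrite (@vertex_neq alpha.+1 1); last by lia].
case: v => x y; rewrite /grid_arrow /on_border /in_grid /= !xpair_eqE /=.
lia.
Qed.

Lemma corner_psi_in v : arr v (alpha.+1, 1%N) && in_grid v
  = (v \in [:: (alpha, 1%N); (beta.+1, n); (alpha.+2, 2)]).
Proof.
rewrite /arrow /extra_arrows !inE !extra_pairE.
do ? [rewrite eqxx | rewrite (@vertex_neq alpha.+1 1); last by lia].
rewrite !andbF !andbT.
case: v => x y; rewrite /grid_arrow /on_border /in_grid /= !xpair_eqE /= !orbF.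
lia.
Qed.

(** The second factor f_(n,alpha+1) also labels a neighbour of (1, beta + 1). *)
Lemma phi_theta_last : ph (n, alpha)
  = f X n alpha * ph (1%N, beta.+1) - f X n alpha.+1 * w_theta X alpha beta.
Proof.
rewrite phiE ?/Phi ?/coefs ?eqxx /=; [|lia..].
rewrite -f_trail ?[f X n alpha.+1]f_trail; [|lia..].
rewrite (@trail1 _ _ _ n alpha.+1) // (@trail_nextE _ _ _ n alpha 0) ?addn0 //.
by rewrite (@itv_nil alpha) ?itv1 //; lia.
Qed.

Lemma phi_psi_last : ph (beta, n)
  = f X beta n * ph (alpha.+1, 1%N) - f X beta.+1 n * w_psi X alpha beta.
Proof.
rewrite phiE ?/Phi ?/coefs; [|lia..].
rewrite ifF ?ifT /=; [|lia..].
rewrite -f_trail; [|lia..]; rewrite -f_down_trail; [|lia..].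
congr (_ - _ * _).
rewrite /f_down /f /fblock !ifT /det_down /det_block /=; [|lia..].
rewrite itv_nil; last by lia.
by rewrite !(addnC n) !addnK !itv1.
Qed.

Lemma exchange_corner_theta :
  exists Q, exchange X alpha beta (1%N, beta.+1) = ph (1%N, beta.+1) * Q.
Proof.
have [Q HQ] := corner_theta_exchange X halpha hab hbeta.
exists (f X n alpha * Ph 2 beta.+1 - f X n alpha.+1 * Q).
rewrite /exchange (@prod_vertices _ [:: (n, alpha); (2, beta.+1)]); last 2 first.
- by rewrite /= !inE xpair_eqE; lia.
- by move=> v; rewrite corner_theta_out.
rewrite (@prod_vertices (fun v => arr v (1%N, beta.+1))
   ([:: (1%N, beta); (n, alpha.+1)] ++ wrap (2, beta.+2))); last 2 first.
- rewrite /= uniq_wrap !inE !mem_wrap /= !xpair_eqE; lia.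
- by move=> v; rewrite corner_theta_in.
rewrite big_cat prod_wrap /=; [|lia..].
rewrite !big_cons !big_nil !mulr1 phi_theta_last [ph (2, _)]phiE; [|lia..].
rewrite [ph (1%N, beta)]phiE; [|lia..].
rewrite [ph (n, alpha.+1)]phi_f; [|lia..].
move: HQ; move: (f _ _ _) (f _ _ _) (w_theta _ _ _) => a b w.
move: (Ph _ _) (Ph _ _) (Ph _ _) (phi _ _ _ _) => x y z u HQ.
by apply: (@eq_of_combination R (- a) 0 _ _ 0 0 _ _ HQ erefl); ring.
Qed.

Lemma exchange_corner_psi :
  exists Q, exchange X alpha beta (alpha.+1, 1%N) = ph (alpha.+1, 1%N) * Q.
Proof.
have [Q HQ] := corner_psi_exchange X halpha hab hbeta.
exists (f X beta n * Ph alpha.+1 2 - f X beta.+1 n * Q).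
rewrite /exchange (@prod_vertices _ [:: (beta, n); (alpha.+1, 2)]); last 2 first.
- by rewrite /= !inE xpair_eqE; lia.
- by move=> v; rewrite corner_psi_out.
rewrite (@prod_vertices (fun v => arr v (alpha.+1, 1%N))
   [:: (alpha, 1%N); (beta.+1, n); (alpha.+2, 2)]); last 2 first.
- by rewrite /= !inE !xpair_eqE; lia.
- by move=> v; rewrite corner_psi_in.
rewrite !big_cons !big_nil !mulr1 phi_psi_last [ph (alpha.+1, 2)]phiE; [|lia..].
rewrite [ph (alpha, 1%N)]phiE; [|lia..].
rewrite [ph (alpha.+2, 2)]phiE; [|lia..].
rewrite [ph (beta.+1, n)]phi_f; [|lia..].
move: HQ; move: (f _ _ _) (f _ _ _) (w_psi _ _ _) => a b w.
move: (Ph _ _) (Ph _ _) (Ph _ _) (phi _ _ _ _) => x y z u HQ.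
by apply: (@eq_of_combination R (- a) 0 _ _ 0 0 _ _ HQ erefl); ring.
Qed.

Lemma exchange_divisible v : in_grid v -> is_mutable alpha beta v ->
  exists Q, exchange X alpha beta v = ph v * Q.
Proof.
case: v => i j hv; rewrite /is_mutable /on_border /= => /or3P[hm|/eqP->|/eqP->].
- move: hv; rewrite /in_grid /= => hv.
  rewrite /exchange prod_out ?prod_in ?phiE; try lia.
  have := @Phi_exchange _ _ X _ _ halpha hab hbeta i.-1 j.-1.
  by rewrite !prednK; [apply|..]; lia.
- exact: exchange_corner_psi.
- exact: exchange_corner_theta.
Qed.

End Neighbours.

(** * Degrees of the minors of the matrix with entries X^(ij) *)

(** The values of s, listed in order, form a sorted enumeration of the ordinals, as the ordinals
    themselves do. *)
Lemma homo_perm1 k (s : 'S_k) : {homo s : i j / (i < j)%N} -> s = 1%g.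
Proof.
move=> hs; have sE : sorted (fun i j : 'I_k => (i < j)%N) (enum 'I_k).
  by have := iota_ltn_sorted 0 k; rewrite -val_enum_ord sorted_map.
have /eq_in_map H : [seq s i | i <- enum 'I_k] = [seq id i | i <- enum 'I_k].
  rewrite map_id; apply: (@irr_sorted_eq _ (fun i j : 'I_k => (i < j)%N)) => //.
  - by move=> x y z; apply: ltn_trans.
  - by move=> x; apply: ltnn.
  - by rewrite sorted_map; apply: sub_sorted sE => i j; apply: hs.
  move=> i; rewrite mem_enum; apply/mapP; exists (s^-1%g i); first by rewrite mem_enum.
  by rewrite permKV.
by apply/permP => i; rewrite perm1 H // mem_enum.
Qed.

(** A permutation that maximizes the sum has no inversion, since removing an inversion by a
    transposition increases the sum; so the identity is the only maximizer. *)
Lemma rearrangement k (r c : 'I_k -> nat) (s : 'S_k) :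
  {homo r : i j / (i < j)%N} -> {homo c : i j / (i < j)%N} -> s != 1%g ->
  (\sum_i r i * c (s i) < \sum_i r i * c i)%N.
Proof.
move=> hr hc.
pose w (t : 'S_k) := (\sum_i r i * c (t i))%N.
have w1 (t : 'S_k) : (forall t' : 'S_k, (w t' <= w t)%N) -> t = 1%g.
  move=> tmax; apply: homo_perm1 => i j ij; rewrite ltnNge; apply/negP => tji.
  have nij : i != j by rewrite neq_ltn ij.
  have {}tji : (t j < t i)%N.
    by rewrite ltn_neqAle tji andbT (inj_eq val_inj) (inj_eq perm_inj) eq_sym.
  have := tmax (tperm i j * t)%g; apply/negP; rewrite -ltnNge /w.
  rewrite (bigD1 i) //= (bigD1 j) 1?eq_sym //= [ltnRHS](bigD1 i) //=.
  rewrite [X in (_ < _ + X)%N](bigD1 j) 1?eq_sym //=.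
  rewrite !permM tpermL tpermR !addnA.
  rewrite [X in (_ < _ + X)%N](eq_bigr (fun l => r l * c (t l))%N)
    => [|l /andP[li lj]]; last first.
    by rewrite permM tpermD // eq_sym.
  rewrite ltn_add2r; have := hr _ _ ij; have := hc _ _ tji; nia.
case: (arg_maxnP w (erefl (xpredT (1%g : 'S_k)))) => t _ tmax.
have {tmax} tmax t' : (w t' <= w t)%N by apply: tmax.
have t1 := w1 t tmax; move=> s1.
have we : w 1%g = (\sum_i r i * c i)%N by apply: eq_bigr => i _; rewrite perm1.
rewrite -we -t1 ltn_neqAle tmax andbT; apply: contra s1 => /eqP ws.
by apply/eqP/w1 => t'; rewrite [w s]ws; apply: tmax.
Qed.

Lemma entryE (R : comNzRingType) n (X : 'M[R]_n) (i j : 'I_n) :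
  entry X i.+1 j.+1 = X i j.
Proof.
rewrite /entry; case: pickP => [a /eqP[/val_inj->]|/(_ i)]; last by rewrite eqxx.
by case: pickP => [b /eqP[/val_inj->]|/(_ j)] //; rewrite eqxx.
Qed.

Section Vandermonde.
Variables (K : idomainType) (n : nat).

Definition power_mx : 'M[{poly K}]_n := \matrix_(i, j) 'X^(i.+1 * j.+1).

Definition weight (rs cs : seq nat) : nat := (\sum_(p <- zip rs cs) p.1 * p.2)%N.

Lemma entry_power_mx i j : (0 < i <= n)%N -> (0 < j <= n)%N -> entry power_mx i j = 'X^(i * j).
Proof.
move=> hi hj; have hi' : (i.-1 < n)%N by lia.
have hj' : (j.-1 < n)%N by lia.
have := entryE power_mx (Ordinal hi') (Ordinal hj').
by rewrite mxE /= !prednK //; lia.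
Qed.

(** By [rearrangement], the identity permutation gives the only term of highest degree. *)
Lemma size_minor_power_mx rs cs : size rs = size cs ->
  sorted ltn rs -> sorted ltn cs ->
  {in rs, forall x, 0 < x <= n}%N -> {in cs, forall x, 0 < x <= n}%N ->
  size (minor power_mx rs cs) = (weight rs cs).+1.
Proof.
move=> sz srs scs rin cin.
pose r (i : 'I_(size rs)) := nth 0%N rs i; pose c (i : 'I_(size rs)) := nth 0%N cs i.
have wE : weight rs cs = (\sum_i r i * c i)%N.
  rewrite /weight (big_nth (0, 0)%N) size1_zip ?sz // big_mkord.
  by apply: eq_bigr => i _; rewrite nth_zip.
have hr : {homo r : i j / (i < j)%N}.
  by move=> i j; rewrite /r => ij; apply: (sorted_ltn_nth ltn_trans); rewrite ?inE.
have hc : {homo c : i j / (i < j)%N}.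
  by move=> i j; rewrite /c => ij; apply: (sorted_ltn_nth ltn_trans); rewrite ?inE -?sz.
rewrite /minor /determinant.
have E (s : 'S_(size rs)) : \prod_i (\matrix_(a, b) entry power_mx (nth 0%N rs a) (nth 0%N cs b)) i (s i)
    = 'X^(\sum_i r i * c (s i))%N.
  rewrite expr_sum; apply: eq_bigr => i _; rewrite mxE entry_power_mx //.
    by apply: rin; rewrite mem_nth.
  by apply: cin; rewrite mem_nth -?sz.
rewrite (bigD1 1%g) //= odd_perm1 expr0 mul1r E.
have -> : (\sum_i r i * c ((1%g : 'S_(size rs)) i) = weight rs cs)%N.
  by rewrite wE; apply: eq_bigr => i _; rewrite perm1.
rewrite size_polyDl size_polyXn // ltnS.
apply: (leq_trans (size_sum _ _ _)); apply/bigmax_leqP => s s1.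
by rewrite size_Msign E size_polyXn wE; apply: rearrangement.
Qed.

End Vandermonde.

Lemma weightC rs cs : weight rs cs = weight cs rs.
Proof.
elim: rs cs => [|r rs IH] [|c cs]; rewrite /weight ?big_nil //= !big_cons /=.
by rewrite mulnC; congr addn; apply: IH.
Qed.

Lemma weight_first r rs c cs :
  weight (r :: rs) (c.+1 :: cs) = (weight (r :: rs) (c :: cs) + r)%N.
Proof. by rewrite /weight /= !big_cons /=; lia. Qed.

Lemma weight_last rs r cs c : size cs = (size rs).+1 -> last 0%N cs = c ->
  weight (rcons rs r.+1) cs = (weight (rcons rs r) cs + c)%N.
Proof.
case/lastP: cs => // cs c'; rewrite size_rcons last_rcons => -[sz] ->.
by rewrite /weight !zip_rcons // !big_rcons /=; lia.
Qed.

Section Degrees.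
Variables (K : idomainType) (n : nat).
Local Notation V := (power_mx K n).

Lemma deg_f i j : (0 < i <= n)%N -> (0 < j <= n)%N ->
  exists d, size (f V i j) = d.+1.
Proof.
move=> hi hj; rewrite /f /fblock /det_block.
by case: leqP => ij /=; eexists; apply: size_minor_power_mx; rewrite ?sorted_itv ?size_itv //;
  try lia; move=> x; rewrite mem_itv; lia.
Qed.

(** The last row is n, so moving the last column by one adds n to the degree. *)
Lemma deg_f_right i j : (0 < j < i)%N -> (i <= n)%N ->
  exists d, size (f V i j) = d.+1 /\ size (f_right V i j) = (d + n).+1.
Proof.
move=> hj hi; have /negPf ij : ~~ (i <= j)%N by lia.
rewrite /f /f_right /fblock ij /det_block /det_right /=.
set m := (n + j - i)%N; have hm : (j <= m < n)%N by rewrite /m; lia.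
have mE : itv j m = rcons (itv j m.-1) m.
  by rewrite -[m in LHS]prednK ?itv_rcons ?cats1 ?prednK //; lia.
have wE : weight (itv i n) (rcons (itv j m.-1) m.+1) = (weight (itv i n) (itv j m) + n)%N.
  by rewrite weightC (@weight_last _ _ _ n) ?last_itv ?mE 1?weightC // !size_itv; lia.
exists (weight (itv i n) (itv j m)); rewrite -wE.
split; apply: size_minor_power_mx;
  rewrite ?sorted_itv ?sorted_rcons_itv ?size_rcons ?size_itv //; try lia;
  by move=> x; rewrite ?mem_rcons ?inE mem_itv; lia.
Qed.

(** The last column is n, so moving the last row by one adds n to the degree. *)
Lemma deg_minor_down i m cs : (0 < i <= m)%N -> (m < n)%N ->
  (i + size cs = m.+1)%N -> sorted ltn cs -> {in cs, forall x, 0 < x <= n}%N ->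
  last 0%N cs = n ->
  exists d, size (minor V (itv i m) cs) = d.+1 /\
   size (minor V (rcons (itv i m.-1) m.+1) cs) = (d + n).+1.
Proof.
move=> hi hm sz scs cin lcs.
have mE : itv i m = rcons (itv i m.-1) m.
  by rewrite -[m in LHS]prednK ?itv_rcons ?cats1 ?prednK //; lia.
have wE : weight (rcons (itv i m.-1) m.+1) cs = (weight (itv i m) cs + n)%N.
  by rewrite (weight_last _ _ lcs) ?mE // !size_itv; lia.
exists (weight (itv i m) cs); rewrite -wE.
split; apply: size_minor_power_mx;
  rewrite ?sorted_itv ?sorted_rcons_itv ?size_rcons ?size_itv //; try lia;
  by move=> x; rewrite ?mem_rcons ?inE mem_itv; lia.
Qed.

Lemma deg_f_down i j : (0 < i < j)%N -> (j <= n)%N ->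
  exists d, size (f V i j) = d.+1 /\ size (f_down V i j) = (d + n).+1.
Proof.
move=> hi hj; have ij : (i <= j)%N by lia.
rewrite /f /f_down /fblock ij /det_block /det_down /=.
apply: deg_minor_down; rewrite ?sorted_itv ?last_itv ?size_itv //; try lia.
by move=> x; rewrite mem_itv; lia.
Qed.

(** The first row is 1, so moving the first column by one subtracts 1 from the degree. *)
Lemma deg_f_left b : (0 < b < n)%N ->
  exists d, size (f V 1 b.+1) = d.+2 /\ size (f_left V 1 b.+1) = d.+1.
Proof.
move=> hb; rewrite /f /f_left /fblock /det_block /det_left /=.
have -> : (n + 1 - b.+1 = n - b)%N by lia.
have wE : weight (itv 1 (n - b)) (itv b.+1 n)
    = (weight (itv 1 (n - b)) (b :: itv b.+2 n)).+1.
  by rewrite (@itv_cons 1) 1?(@itv_cons b.+1) ?weight_first ?addn1 //; lia.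
exists (weight (itv 1 (n - b)) (b :: itv b.+2 n)).
split; [rewrite -wE|]; apply: size_minor_power_mx;
  rewrite ?sorted_itv ?sorted_cons_itv /= ?size_itv //; try lia;
  by move=> x; rewrite ?inE mem_itv; lia.
Qed.

(** The first column is 1, so moving the first row by one subtracts 1 from the degree. *)
Lemma deg_minor_up a cs : (0 < a < n)%N -> (a + size cs = n)%N ->
  head 0%N cs = 1%N -> sorted ltn cs -> {in cs, forall x, 0 < x <= n}%N ->
  exists d, size (minor V (itv a.+1 n) cs) = d.+2
    /\ size (minor V (a :: itv a.+2 n) cs) = d.+1.
Proof.
case: cs => [|c cs] ha sz /= hc scs cin; first by lia.
have wE : weight (itv a.+1 n) (c :: cs)
    = (weight (a :: itv a.+2 n) (c :: cs)).+1.
  by rewrite (@itv_cons a.+1) 1?weightC ?weight_first 1?weightC ?hc ?addn1 //; lia.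
exists (weight (a :: itv a.+2 n) (c :: cs)).
split; [rewrite -wE|]; apply: size_minor_power_mx;
  rewrite ?sorted_itv ?sorted_cons_itv /= ?size_itv //; move=> /= in sz;  try lia;
  by move=> x; rewrite ?inE mem_itv; lia.
Qed.

End Degrees.

(** * The cluster variables do not vanish on this matrix *)

Lemma degM (K : idomainType) (p q : {poly K}) a b :
  size p = a.+1 -> size q = b.+1 -> size (p * q) = (a + b).+1.
Proof.
move=> hp hq; rewrite size_mul -?size_poly_eq0 ?hp ?hq //=; lia.
Qed.

Lemma degB (K : idomainType) (p q : {poly K}) a b :
  size p = a.+1 -> size q = b.+1 -> (a < b)%N -> size (p - q) = b.+1.
Proof.
by move=> hp hq ab; rewrite addrC size_polyDl size_polyN hq // hp ltnS.
Qed.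

Section Nonvanishing.
Variables (K : idomainType) (n alpha beta : nat).
Hypotheses (halpha : (1 <= alpha)%N) (hab : (alpha < beta)%N)
           (hbeta : (beta < n)%N).
Local Notation V := (power_mx K n).

(** When beta = n/2 both polynomials are differences of two products, in which the subtracted
    product has the larger degree, by n - 1; the comparison of these two
    products is again the comparison of a minor with its left shift. *)
Lemma deg_corner_theta : exists d, size (phi V alpha beta (1, beta.+1)%N) = d.+2
  /\ size (w_theta V alpha beta) = d.+1.
Proof.
have b0 : (0 < beta < n)%N by lia.
have [d [hf hl]] := deg_f_left K b0.
rewrite phi_corner_theta // /w_theta; case: eqP => nb; last by exists d.
have [b [hU hW]] : exists b, size (f V alpha.+1 1) = b.+2 /\ size (f_up V alpha.+1 1) = b.+1.
  rewrite /f /f_up /fblock ltnS leqn0 gtn_eqF // /det_block /det_up /=.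
  apply: deg_minor_up; rewrite ?size_itv ?sorted_itv //; try lia.
    by rewrite itv_cons //; lia.
  by move=> x; rewrite mem_itv; lia.
have [d' [hA hB]] : exists d, size (f V 1 beta.+1) = d.+1
    /\ size (f_down V 1 beta.+1) = (d + n).+1.
  by apply: deg_f_down; lia.
have [e [hA' hB']] : exists d, size (f_left V 1 beta.+1) = d.+1 /\
   size (minor V (rcons (itv 1 beta.-1) beta.+1) (beta :: itv beta.+2 n)) = (d + n).+1.
  rewrite /f_left /fblock /det_left /= (_ : n + 1 - beta.+1 = beta)%N; last by lia.
  apply: deg_minor_down; rewrite ?sorted_cons_itv //= ?size_itv ?last_itv //; try lia.
  by move=> x; rewrite inE mem_itv; lia.
have {}hB : size (f_down V 1 beta.+1) = (d.+1 + n).+1 by rewrite hB; lia.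
have {}hB' : size (minor V (rcons (itv 1 beta.-1) beta.+1) (beta :: itv beta.+2 n))
  = (d + n).+1 by rewrite hB'; lia.
exists (d + n + b)%N; split.
  rewrite /psi_gen (_ : n + 1 - beta = beta.+1)%N; last by lia.
  by rewrite (degB (degM hf hU) (degM hB hW)); lia.
rewrite /psi1_star.
have -> : minor V (itv 1 beta) (beta :: itv beta.+2 n) = f_left V 1 beta.+1.
  by rewrite /f_left /fblock /det_left /=; congr (minor _ (itv _ _) _); lia.
by rewrite (degB (degM hl hU) (degM hB' hW)); lia.
Qed.

Lemma deg_corner_psi : exists d, size (phi V alpha beta (alpha.+1, 1)%N) = d.+2
  /\ size (w_psi V alpha beta) = d.+1.
Proof.
have a0 : (0 < alpha < n)%N by lia.
have [d [hf hu]] : exists b, size (f V alpha.+1 1) = b.+2 /\ size (f_up V alpha.+1 1) = b.+1.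
  rewrite /f /f_up /fblock ltnS leqn0 gtn_eqF // /det_block /det_up /=.
  apply: deg_minor_up; rewrite ?size_itv ?sorted_itv //; try lia.
    by rewrite itv_cons //; lia.
  by move=> x; rewrite mem_itv; lia.
rewrite phi_corner_psi // /w_psi; case: eqP => na; last by exists d.
have b0 : (0 < beta < n)%N by lia.
have [b [hU hW]] := deg_f_left K b0.
have [d' [hA hB]] : exists d, size (f V alpha.+1 1) = d.+1
    /\ size (f_right V alpha.+1 1) = (d + n).+1.
  by apply: deg_f_right; lia.
have [e [hA' hB']] : exists d, size (f_right V alpha.+1 1) = d.+2 /\
   size (minor V (alpha :: itv alpha.+2 n) (rcons (itv 1 alpha.-1) alpha.+1)) = d.+1.
  rewrite /f_right /fblock ltnS leqn0 gtn_eqF //= /det_right /=.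
  rewrite (_ : n + 1 - alpha.+1 = alpha)%N; last by lia.
  apply: deg_minor_up; rewrite ?sorted_rcons_itv ?size_rcons ?size_itv //; try lia.
    by rewrite itv_cons //; lia.
  by move=> x; rewrite mem_rcons inE mem_itv; lia.
have {}hB : size (f_right V alpha.+1 1) = (d.+1 + n).+1 by rewrite hB; lia.
have {}hB' : size (minor V (alpha :: itv alpha.+2 n) (rcons (itv 1 alpha.-1) alpha.+1))
  = (d + n).+1 by rewrite hB'; lia.
exists (d + n + b)%N; split.
  rewrite /theta_gen (_ : n + 1 - alpha = alpha.+1)%N; last by lia.
  by rewrite (degB (degM hf hU) (degM hB hW)); lia.
rewrite /theta1_star.
have -> : minor V (alpha :: itv alpha.+2 n) (itv 1 alpha) = f_up V alpha.+1 1.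
  rewrite /f_up /fblock ltnS leqn0 gtn_eqF //= /det_up /=.
  by congr (minor _ _ (itv _ _)); lia.
by rewrite (degB (degM hu hU) (degM hB' hW)); lia.
Qed.

(** On a special diagonal the subtracted product wins: passing from A_ij u to A'_ij w adds n to
    the degree of the first factor and subtracts 1 from that of the second. *)
Lemma phi_power_mx_neq0 v : in_grid n v -> phi V alpha beta v != 0.
Proof.
case: v => i j /andP[/= hi hj]; rewrite -size_poly_eq0 phiE // /Phi /coefs.
case: (i + alpha =P n + j)%N => [h1|_].
  rewrite -f_trail // -f_right_trail; last by lia.
  have [d [hu hw]] := deg_corner_theta.
  have [||e [hf hr]] := @deg_f_right K n i j; [lia..|].
  by rewrite (degB (degM hf hu) (degM hr hw)); lia.
case: (j + beta =P n + i)%N => [h2|_].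
  rewrite -f_trail // -f_down_trail; [|lia..].
  have [d [hu hw]] := deg_corner_psi.
  have [||e [hf hr]] := @deg_f_down K n i j; [lia..|].
  by rewrite (degB (degM hf hu) (degM hr hw)); lia.
rewrite mulr1 mulr0 subr0 -f_trail //.
by have [d ->] := deg_f K hi hj.
Qed.

End Nonvanishing.

Lemma minor_full (R : comNzRingType) n (X : 'M[R]_n) :
  minor X (itv 1 n) (itv 1 n) = \det X.
Proof.
rewrite minor_ext; last by move=> x; rewrite mem_itv; lia.
rewrite (@minor_ofE _ _ _ _ n) ?size_itv ?subn1 //; congr (\det _).
apply/matrixP => i j; rewrite !mxE !nth_iota ?subn1 //= !add1n.
by rewrite /ext_entry ltn_ord entryE.
Qed.

Lemma det_power_mx_neq0 (K : idomainType) n : \det (power_mx K n) != 0.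
Proof.
rewrite -minor_full -size_poly_eq0 size_minor_power_mx ?sorted_itv //;
  by move=> x; rewrite mem_itv.
Qed.

(** * Ring morphisms and scaling *)

Section Functoriality.
Variables (R S : comNzRingType) (h : {rmorphism R -> S}) (n : nat) (X : 'M[R]_n).

Lemma entry_map i j : entry (map_mx h X) i j = h (entry X i j).
Proof.
rewrite /entry; case: pickP => [a _|_]; last by rewrite rmorph0.
by case: pickP => [b _|_]; rewrite ?rmorph0 ?mxE.
Qed.

Lemma minor_map rs cs : minor (map_mx h X) rs cs = h (minor X rs cs).
Proof.
rewrite /minor -det_map_mx; congr (\det _); apply/matrixP => i j.
by rewrite !mxE entry_map.
Qed.

Lemma phi_map alpha beta v : phi (map_mx h X) alpha beta v = h (phi X alpha beta v).
Proof.
case: v => i j; rewrite /phi; do !case: ifP => _;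
  rewrite /theta /psi ?[in RHS](fun_if h); try case: ifP => _;
  rewrite /psi_gen /theta_gen /psi1_star /theta1_star /f /f_right /f_left /f_down /f_up
    /det_block /det_right /det_left /det_down /det_up !minor_map ?rmorphB ?rmorphM //=.
all: by rewrite ?rmorphB ?rmorphM.
Qed.

Lemma exchange_map alpha beta v :
  exchange (map_mx h X) alpha beta v = h (exchange X alpha beta v).
Proof.
rewrite /exchange rmorphD !rmorph_prod.
by congr (_ + _); apply: eq_bigr => q _; rewrite phi_map.
Qed.

End Functoriality.

Section Homogeneity.
Variables (R : comNzRingType) (n : nat) (X : 'M[R]_n) (c : R).

Lemma minor_scale rs cs : minor (c *: X) rs cs = c ^+ size rs * minor X rs cs.
Proof.
rewrite /minor -detZ; congr (\det _); apply/matrixP => i j; rewrite !mxE.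
rewrite /entry; case: pickP => [a _|_]; last by rewrite mulr0.
by case: pickP => [b _|_]; rewrite ?mulr0 ?mxE.
Qed.

Lemma f_scale i j : (0 < i <= n)%N -> (0 < j <= n)%N ->
  f (c *: X) i j = c ^+ (n.+1 - maxn i j) * f X i j.
Proof.
move=> hi hj; rewrite /f /fblock /det_block.
by case: leqP => ij /=; rewrite minor_scale size_itv; congr (_ ^+ _ * _); lia.
Qed.

Lemma f_right_scale i j : (0 < j < i)%N -> (i <= n)%N ->
  f_right (c *: X) i j = c ^+ (n.+1 - maxn i j) * f_right X i j.
Proof.
move=> hi hj; rewrite /f_right /fblock /det_right.
by case: leqP => ij /=; rewrite minor_scale size_itv; congr (_ ^+ _ * _); lia.
Qed.

Lemma f_down_scale i j : (0 < i < j)%N -> (j <= n)%N ->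
  f_down (c *: X) i j = c ^+ (n.+1 - maxn i j) * f_down X i j.
Proof.
move=> hi hj; rewrite /f_down /fblock /det_down.
case: leqP => ij /=; rewrite minor_scale size_rcons size_itv;
  by congr (_ ^+ _ * _); lia.
Qed.

Lemma f_left_scale b : (0 < b < n)%N ->
  f_left (c *: X) 1 b.+1 = c ^+ (n - b) * f_left X 1 b.+1.
Proof.
move=> hb; rewrite /f_left /fblock /det_left /= minor_scale size_itv.
by congr (_ ^+ _ * _); lia.
Qed.

Lemma f_up_scale a : (0 < a < n)%N ->
  f_up (c *: X) a.+1 1 = c ^+ (n - a) * f_up X a.+1 1.
Proof.
move=> ha; rewrite /f_up /fblock ltnS leqn0 gtn_eqF /det_up //=; last by lia.
by rewrite minor_scale /= size_itv; congr (_ ^+ _ * _); lia.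
Qed.

Lemma mulB_homogeneous e e' p q r s :
  c ^+ e * p * (c ^+ e' * q) - c ^+ e * r * (c ^+ e' * s)
  = c ^+ (e + e') * (p * q - r * s).
Proof. by rewrite exprD; ring. Qed.

Variables (alpha beta : nat).
Hypotheses (halpha : (1 <= alpha)%N) (hab : (alpha < beta)%N)
           (hbeta : (beta < n)%N).

Lemma corner_theta_scale : exists e,
  phi (c *: X) alpha beta (1, beta.+1)%N = c ^+ e * phi X alpha beta (1, beta.+1)%N
  /\ w_theta (c *: X) alpha beta = c ^+ e * w_theta X alpha beta.
Proof.
rewrite !phi_corner_theta // /w_theta.
case: (beta.*2 =P n) => nb; last first.
  exists (n - beta)%N; rewrite f_scale ?f_left_scale; [|lia..].
  by split=> //; congr (_ ^+ _ * _); lia.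
exists (n - beta + (n - alpha))%N; split.
  rewrite /psi_gen f_scale ?[f _ alpha.+1 1]f_scale ?f_down_scale ?f_up_scale; [|lia..].
  rewrite (_ : n.+1 - maxn alpha.+1 1 = n - alpha)%N ?mulB_homogeneous; last by lia.
  by congr (_ ^+ (_ + _) * _); lia.
rewrite /psi1_star f_scale ?f_up_scale ?minor_scale; [|lia..].
rewrite size_rcons !size_itv (_ : n.+1 - maxn alpha.+1 1 = n - alpha)%N; last by lia.
rewrite (_ : (beta.-1.+1 - 1).+1 = beta.+1 - 1)%N; last by lia.
by rewrite mulB_homogeneous; congr (_ ^+ (_ + _) * _); lia.
Qed.

Lemma corner_psi_scale : exists e,
  phi (c *: X) alpha beta (alpha.+1, 1)%N = c ^+ e * phi X alpha beta (alpha.+1, 1)%N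
  /\ w_psi (c *: X) alpha beta = c ^+ e * w_psi X alpha beta.
Proof.
rewrite !phi_corner_psi // /w_psi.
case: (alpha.*2 =P n) => na; last first.
  exists (n - alpha)%N; rewrite f_scale ?f_up_scale; [|lia..].
  by split=> //; congr (_ ^+ _ * _); lia.
exists (n - alpha + (n - beta))%N; split.
  rewrite /theta_gen f_scale ?[f _ 1 beta.+1]f_scale ?f_right_scale ?f_left_scale; [|lia..].
  rewrite (_ : n.+1 - maxn 1 beta.+1 = n - beta)%N ?mulB_homogeneous; last by lia.
  by congr (_ ^+ (_ + _) * _); lia.
rewrite /theta1_star f_scale ?f_left_scale ?minor_scale; [|lia..].
rewrite /= !size_itv (_ : n.+1 - maxn 1 beta.+1 = n - beta)%N; last by lia.
by rewrite mulB_homogeneous; congr (_ ^+ (_ + _) * _); lia.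
Qed.

(** The two products in phi_ij have the same degree in the entries of X. *)
Lemma phi_scale v : in_grid n v ->
  exists e, phi (c *: X) alpha beta v = c ^+ e * phi X alpha beta v.
Proof.
case: v => i j /andP[/= hi hj]; rewrite !phiE // /Phi /coefs.
case: (i + alpha =P n + j)%N => [h1|_].
  rewrite -!f_trail // -!f_right_trail; [|lia..].
  have [e [-> ->]] := corner_theta_scale.
  by rewrite f_scale // f_right_scale ?mulB_homogeneous; [eexists|lia..].
case: (j + beta =P n + i)%N => [h2|_].
  rewrite -!f_trail // -!f_down_trail; [|lia..].
  have [e [-> ->]] := corner_psi_scale.
  by rewrite f_scale // f_down_scale ?mulB_homogeneous; [eexists|lia..].
by rewrite !mulr1 !mulr0 !subr0 -!f_trail // f_scale //; eexists.
Qed.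

End Homogeneity.

(** * Points of SL_n, and regularity *)

Section Evaluation.
Variables (C : fieldType) (n : nat) (A : 'M[C]_n).

Let ev := (@meval (n * n) C (fun t => mxvec A 0 t)).

Lemma eval_generic : map_mx ev (genericX C n) = A.
Proof. by apply/matrixP => i j; rewrite !mxE /ev mevalXU mxvecE. Qed.

End Evaluation.

(** The polynomial phi_v det X in t is not zero, hence does not vanish at some t; an n-th root
    rescales the resulting invertible matrix to determinant 1. *)
Lemma phi_nonzero_SL (C : numClosedFieldType) n alpha beta v :
  (1 <= alpha)%N -> (alpha < beta)%N -> (beta < n)%N ->
  in_grid n v ->
  exists2 A : 'M[C]_n, \det A = 1 & phi A alpha beta v != 0.
Proof.
move=> ha hab hb hv.
have : phi (power_mx C n) alpha beta v * \det (power_mx C n) != 0.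
  by rewrite mulf_neq0 ?phi_power_mx_neq0 ?det_power_mx_neq0.
case/closed_nonrootP => t; rewrite rootE hornerM mulf_eq0 negb_or.
pose B := map_mx (horner_eval t) (power_mx C n).
have -> : (phi (power_mx C n) alpha beta v).[t] = phi B alpha beta v by rewrite phi_map.
have -> : (\det (power_mx C n)).[t] = \det B by rewrite det_map_mx.
case/andP=> pB dB; pose c := n.-root (\det B)^-1.
have n0 : (0 < n)%N by lia.
have cn : c ^+ n = (\det B)^-1 by rewrite rootCK.
exists (c *: B); first by rewrite detZ cn mulVf.
have [e ->] := phi_scale B c ha hab hb hv.
rewrite mulf_neq0 // expf_neq0 //; apply: contraNneq dB => c0.
by rewrite -invr_eq0 -cn c0 expr0n gtn_eqF.
Qed.

Unset Implicit Arguments.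

(* The first conjunct says that phi_p is not identically zero on SL_n, hence
   not on GL_n either, so that the exchange relation does define phi'_p. *)
Theorem theorem5p1 (C : numClosedFieldType) (n alpha beta : nat)
    (hn : (3 <= n)%N) (halpha : (1 <= alpha)%N) (hab : (alpha < beta)%N)
    (hbeta : (beta <= n - 1)%N)
    (v : 'I_n * 'I_n) (hv : is_mutable alpha beta (lbl v)) :
  [/\ exists2 A : 'M[C]_n, \det A = 1 & phi A alpha beta (lbl v) != 0,
      regular_GL (exchanged C n alpha beta (lbl v))
    & exists2 h : 'M[C]_n -> C,
        regular_SL h & exchanged_SL alpha beta (lbl v) h].
Proof.
have hb : (beta < n)%N by lia.
have hg : in_grid n (lbl v).
  by rewrite -mem_lbl map_f ?mem_index_enum.
have [Q HQ] := exchange_divisible (genericX C n) halpha hab hb hg hv.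
have nz := phi_nonzero_SL C halpha hab hb hg.
split=> //.
- exists Q, 0%N; rewrite /exchanged expr0 divr1 HQ rmorphM mulrAC divff ?mul1r //.
  rewrite tofrac_eq0; case: nz => A _; apply: contraNneq => p0.
  by rewrite -[A]eval_generic phi_map p0 rmorph0.
exists (fun A => eval_at A Q); first by exists Q.
move=> A _; rewrite -{1 3}[A]eval_generic phi_map exchange_map HQ.
by rewrite rmorphM.
Qed.
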